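(* Let $(c_{ih}^n,p_{ih}^n,\psi_h^n)$, $i=1,\dots,m$, be the solution of the fully discrete (Euler forward) DG scheme described in the context, with uniform time step $\Delta t$. 1. The fully discrete scheme is conservative in the sense that each total concentration $c_{ih}^n$ ($i=1,\dots,m$) remains unchanged in time: $$\sum_{j=1}^N\int_{I_j}c_{ih}^n\,dx=\sum_{j=1}^N\int_{I_j}c_{ih}^{n+1}\,dx,\qquad i=1,\dots,m.$$ 2. Assume that $c_{ih}^n(x)>0$ in each $I_j$. There exists $\mu^*>0$ such that if the mesh ratio $\mu=\frac{\Delta t}{\Delta x^2}\in(0,\mu^* )$, then the fully discrete free energy $$F^n=\sum_{j=1}^N\int_{I_j}\Big[\sum_{i=1}^mc_{ih}^n\log c_{ih}^n+\frac12\Big(\sum_{i=1}^mq_ic_{ih}^n+\rho_0\Big)\psi_h^n\Big]dx+\frac12\int_{\partial\Omega}\sigma\psi_h^n\,ds$$ satisfies $$\frac{F^{n+1}-F^n}{\Delta t}\le-\frac12\sum_{i=1}^mA_{c_{ih}^n}(p_{ih}^n,p_{ih}^n).$$ Moreover, $$F^{n+1}\le F^n,$$ provided that $\beta_0$ is suitably large, and $\beta_1=0$ in the flux $Fl(\psi_h)$.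
   Context: Mesh and space: $\Omega=[a,b]$ is partitioned by a mesh, not necessarily uniform, into $N$ cells $I_j=(x_{j-1/2},x_{j+1/2})$ with $a=x_{1/2}<x_{3/2}<\dots<x_{N+1/2}=b$; $h$, also written $\Delta x$, denotes the characteristic mesh length. $V_h=\{v\in L^2(\Omega): v|_{I_j}\in P^k(I_j),\ j=1,\dots,N\}$, $P^k$ being the polynomials of degree at most $k$. Data: charges $q_1,\dots,q_m$; a fixed charge $\rho_0(x)$; Neumann data $\sigma$ for the potential, with values $\sigma_a,\sigma_b$ of $\partial_x\psi$ at $a,b$, and the convention $\int_{\partial\Omega}\sigma\eta\,ds=\sigma_b\,\eta(b^-)-\sigma_a\,\eta(a^+)$. The initial data $c_{ih}^0$ are the $L^2$ projections onto $V_h$ of given initial concentrations $c_i^{\rm in}$ that satisfy the compatibility condition $\int_\Omega(\sum_{i=1}^mq_ic_i^{\rm in}+\rho_0)\,dx+\int_{\partial\Omega}\sigma\,ds=0$. Fluxes: at an interior interface, $q^\pm$ are the right/left limits of $q$, $[q]=q^+-q^-$, $\{q\}=(q^++q^-)/2$. With parameters $\beta_0,\beta_1$, which may be chosen differently for $p_{ih}^n$ and for $\psi_h^n$, $$Fl(w)=\beta_0\frac{[w]}{h}+\{\partial_xw\}+\beta_1h[\partial_x^2w].$$ $(\cdot)|_{\partial I_j}$ is the value at $x_{j+1/2}$ minus the value at $x_{j-1/2}$, un-averaged functions being evaluated by limits from inside $I_j$. Fully discrete scheme: $c_{ih}^n,p_{ih}^n,\psi_h^n\in V_h$ and for all $v_i,r_i,\eta\in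 V_h$, all $j=1,\dots,N$, all $i=1,\dots,m$, $$\int_{I_j}\frac{c_{ih}^{n+1}-c_{ih}^n}{\Delta t}v_i\,dx=-\int_{I_j}c_{ih}^n\partial_xp_{ih}^n\partial_xv_i\,dx+\{c_{ih}^n\}\big(\widehat{\partial_xp_{ih}^n}v_i+(p_{ih}^n-\{p_{ih}^n\})\partial_xv_i\big)\big|_{\partial I_j},$$ $$\int_{I_j}p_{ih}^nr_i\,dx=\int_{I_j}(q_i\psi_h^n+\log c_{ih}^n)r_i\,dx,$$ $$\int_{I_j}\partial_x\psi_h^n\partial_x\eta\,dx-\big(\widehat{\partial_x\psi_h^n}\eta+(\psi_h^n-\{\psi_h^n\})\partial_x\eta\big)\big|_{\partial I_j}=\int_{I_j}\Big(\sum_{i=1}^mq_ic_{ih}^n+\rho_0\Big)\eta\,dx,$$ where at interior interfaces $\widehat{\partial_xp_{ih}^n}=Fl(p_{ih}^n)$, $\widehat{\partial_x\psi_h^n}=Fl(\psi_h^n)$, and at the boundary points $a,b$: $\widehat{\partial_xp_{ih}^n}=0$, $\{p_{ih}^n\}=p_{ih}^n$, $\{c_{ih}^n\}=c_{ih}^n$, $\{\psi_h^n\}=\psi_h^n$, and $\widehat{\partial_x\psi_h^n}=\sigma$ (i.e. $\sigma_a$ at $a$, $\sigma_b$ at $b$). For a positive function $M$, $$A_M(u,v)=\sum_{j=1}^N\int_{I_j}M\,\partial_xu\,\partial_xv\,dx+\sum_{j=1}^{N-1}\Big(\{M\}\big(Fl(u)[v]+\{\partial_xv\}[u]\big)\Big)_{j+1/2},$$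 where in $A_{c_{ih}^n}(p_{ih}^n,p_{ih}^n)$ the flux $Fl$ has the parameters used for $p_{ih}^n$.
   Formalization: The proviso ''β₀ suitably large (in both fluxes, for p depending on c^n and its β₁) and β₁=0 in Fl(ψ_h)'' is required for the first energy inequality too, which fails without it, e.g. when A<0; μ* may depend on c^n, the mesh and the flux parameters. *)

(* Defs.v *)
From HB Require Import structures.
From mathcomp Require Import all_boot all_order all_algebra.
From mathcomp Require Import all_classical all_reals all_analysis.

Set Implicit Arguments.
Unset Strict Implicit.
Unset Printing Implicit Defensive.

Import Order.TTheory GRing.Theory Num.Theory.
Local Open Scope ring_scope.

(* Cells are numbered from 0: cell j is the open interval                     *)
(* ]node j, node j.+1[ for j < ncell, so a = node 0 and b = node ncell, and   *)
(* the interior interfaces are the node i with 0 < i < ncell.  The            *)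
(* characteristic length h = \Delta x is any positive number.                 *)
Record mesh (R : realType) := Mesh {
  ncell : nat;
  node : nat -> R;
  hx : R;
  ncell_gt0 : (0 < ncell)%N;
  node_lt : forall j, (j < ncell)%N -> node j < node j.+1;
  hx_gt0 : 0 < hx }.

(* A piecewise polynomial is given by its polynomial on each cell (values     *)
(* beyond the last cell are never used).  Its one-sided limits at an          *)
(* interface are the values there of the two adjacent polynomials.            *)
Definition broken (R : realType) := nat -> {poly R}.

Record flux_param (R : realType) := FluxParam { beta0 : R; beta1 : R }.

Record pnp_data (R : realType) (m : nat) := PnpData {
  charge : 'I_m -> R;
  rho0 : R -> R;
  sigma_a : R;
  sigma_b : R }.

Section DG.
Variables (R : realType) (Mh : mesh R).
Local Notation N := (ncell Mh).
Local Notation x := (node Mh).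
Local Notation h := (hx Mh).
Local Notation leb := (@lebesgue_measure R).

Definition Omega : set R := `[x 0%N, x N]%classic.

Definition cell (j : nat) : set R := `](x j), (x j.+1)[%classic.

Definition cell_int (j : nat) (f : R -> R) : R := \int[leb]_(y in cell j) f y.

Definition in_Vh (k : nat) (v : broken R) : Prop :=
  forall j, (j < N)%N -> (size (v j) <= k.+1)%N.

Definition dx (w : broken R) : broken R := fun j => (w j)^`().

Definition jump (w : broken R) (i : nat) : R := (w i).[x i] - (w i.-1).[x i].

Definition avg (w : broken R) (i : nat) : R :=
  if i == 0%N then (w 0%N).[x 0%N]
  else if i == N then (w N.-1).[x N]
  else ((w i).[x i] + (w i.-1).[x i]) / 2%:R.

Definition Fl (P : flux_param R) (w : broken R) (i : nat) : R :=
  beta0 P * (jump w i / h) + avg (dx w) i + beta1 P * h * jump (dx (dx w)) i.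

Definition hat_p (P : flux_param R) (p : broken R) (i : nat) : R :=
  if (0 < i < N)%N then Fl P p i else 0.

Definition hat_psi (P : flux_param R) (sa sb : R) (psi : broken R) (i : nat)
    : R :=
  if i == 0%N then sa else if i == N then sb else Fl P psi i.

(* g receives the node index at which it is evaluated; un-averaged functions  *)
(* inside g must be taken from the polynomial of cell j.                      *)
Definition bracket (j : nat) (g : nat -> R) : R := g j.+1 - g j.

Definition AM (P : flux_param R) (M u v : broken R) : R :=
  \sum_(0 <= j < N)
     cell_int j (fun y => (M j).[y] * (dx u j).[y] * (dx v j).[y])
  + \sum_(1 <= i < N)
     avg M i * (Fl P u i * jump v i + avg (dx v) i * jump u i).

(* \int_{\partial\Omega} \sigma \eta ds *)
Definition bdry_int (sa sb : R) (eta : broken R) : R :=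
  sb * (eta N.-1).[x N] - sa * (eta 0%N).[x 0%N].

Section Scheme.
Variables (m : nat) (D : pnp_data R m) (k : nat).
Local Notation q := (charge D).

Definition compatible (cin : 'I_m -> R -> R) : Prop :=
  \int[leb]_(y in Omega) (\sum_(i < m) q i * cin i y + rho0 D y)
  + (sigma_b D - sigma_a D) = 0.

Definition L2_projection (f : R -> R) (c : broken R) : Prop :=
  in_Vh k c /\
  forall v, in_Vh k v ->
    \sum_(0 <= j < N) cell_int j (fun y => (c j).[y] * (v j).[y]) =
    \sum_(0 <= j < N) cell_int j (fun y => f y * (v j).[y]).

Definition euler_eq (Pp : flux_param R) (dt : R) (c c' p : broken R) : Prop :=
  forall v, in_Vh k v -> forall j, (j < N)%N ->
    cell_int j (fun y => ((c' j).[y] - (c j).[y]) / dt * (v j).[y]) =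
    - cell_int j (fun y => (c j).[y] * (dx p j).[y] * (dx v j).[y])
    + bracket j (fun i =>
        avg c i * (hat_p Pp p i * (v j).[x i]
                   + ((p j).[x i] - avg p i) * (dx v j).[x i])).

(* ln is total in the library, with ln y = 0 for y <= 0. *)
Definition potential_eq (qi : R) (c p psi : broken R) : Prop :=
  forall r, in_Vh k r -> forall j, (j < N)%N ->
    cell_int j (fun y => (p j).[y] * (r j).[y]) =
    cell_int j (fun y => (qi * (psi j).[y] + ln (c j).[y]) * (r j).[y]).

Definition poisson_eq (Ps : flux_param R) (c : 'I_m -> broken R)
    (psi : broken R) : Prop :=
  forall eta, in_Vh k eta -> forall j, (j < N)%N ->
    cell_int j (fun y => (dx psi j).[y] * (dx eta j).[y])
    - bracket j (fun i =>
        hat_psi Ps (sigma_a D) (sigma_b D) psi i * (eta j).[x i]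
        + ((psi j).[x i] - avg psi i) * (dx eta j).[x i]) =
    cell_int j (fun y =>
      (\sum_(i < m) q i * (c i j).[y] + rho0 D y) * (eta j).[y]).

(* Solution on the time levels 0, ..., T, with fluxes of parameters Pp for    *)
(* the p_i and Ps for psi, started from the initial concentrations cin.       *)
Definition dg_solution (Pp Ps : flux_param R) (dt : R)
    (cin : 'I_m -> R -> R) (T : nat)
    (c p : nat -> 'I_m -> broken R) (psi : nat -> broken R) : Prop :=
  [/\ forall i, leb.-integrable Omega (EFin \o cin i),
      compatible cin,
      forall i, L2_projection (cin i) (c 0%N i),
      forall n, (n <= T)%N ->
        [/\ forall i, in_Vh k (c n i) /\ in_Vh k (p n i),
            in_Vh k (psi n),
            forall i, potential_eq (q i) (c n i) (p n i) (psi n)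
          & poisson_eq Ps (c n) (psi n)]
    & forall n, (n < T)%N ->
        forall i, euler_eq Pp dt (c n i) (c n.+1 i) (p n i)].

Definition free_energy (c : 'I_m -> broken R) (psi : broken R) : R :=
  \sum_(0 <= j < N) cell_int j (fun y =>
     \sum_(i < m) (c i j).[y] * ln (c i j).[y]
     + 2%:R^-1 * (\sum_(i < m) q i * (c i j).[y] + rho0 D y) * (psi j).[y])
  + 2%:R^-1 * bdry_int (sigma_a D) (sigma_b D) psi.

Definition positive_on_cells (c : broken R) : Prop :=
  forall j, (j < N)%N -> forall y, cell j y -> 0 < (c j).[y].

Definition total_mass (c : broken R) : R :=
  \sum_(0 <= j < N) cell_int j (fun y => (c j).[y]).

End Scheme.
End DG.

(* Main.v *)
Require Import Defs.
From HB Require Import structures.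
From mathcomp Require Import all_boot all_order all_algebra.
From mathcomp Require Import all_classical all_reals all_analysis.
From mathcomp Require Import measurable_realfun ring lra.

Set Implicit Arguments.
Unset Strict Implicit.
Unset Printing Implicit Defensive.

Import Order.TTheory GRing.Theory Num.Theory.
Import numFieldNormedType.Exports.
Local Open Scope ring_scope.

(* Summing the cellwise schemes turns them into
     sum_j \int (c^{n+1} - c^n) v = - dt A_c(p, v)   and   A_1(psi, eta) = L(eta),
   and v = 1 gives conservation of mass.  For beta0 large A_c is positive
   semidefinite (inverse trace inequalities obtained from Riesz representers on
   each cell), and A_1 is symmetric because beta1 = 0 for psi.  Positive
   semidefiniteness determines psi^n up to a constant, p^n up to constants and
   hence the rate G = (c^{n+1} - c^n) / dt, so that c^{n+1} = c^n + dt G with G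
   independent of dt.  The electrostatic energy is then exactly quadratic in dt,
   while the entropy is differentiable at dt = 0 by dominated convergence; the
   concentrations may vanish at cell ends, but ln c is integrable there.
   Altogether F^{n+1} - F^n = - dt (sum_i A_{c_i}(p_i, p_i) + o(1)).  If the sum is
   positive, a small dt gives half of it; if it is zero, then G = 0. *)

(** * Integrals over a cell *)

Section Interval.
Local Open Scope classical_set_scope.
Variables (R : realType) (a b : R).
Hypothesis ab : a < b.
Local Notation mu := (@lebesgue_measure R).
Local Notation I := (`]a, b[%classic : set R).

Lemma poly_bounded_itv (P : {poly R}) :
  exists2 B : R, 0 < B & forall y, I y -> `|P.[y]| <= B.
Proof.
have cP : {within `[a, b], continuous (horner P)}.
  by apply: continuous_subspaceT => y; exact: continuous_horner.
have /compact_bounded[M [_ hM]] := continuous_compact cP (@segment_compact R a b).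
exists (`|M| + 1); first by rewrite ltr_pwDr.
move=> y Iy; apply: hM; first by rewrite (le_lt_trans (ler_norm M)) // ltrDl.
by exists y => //; exact: subset_itv_oo_cc Iy.
Qed.

Lemma integrable_horner (P : {poly R}) : mu.-integrable I (EFin \o horner P).
Proof.
apply: (@integrableS _ _ _ mu `[a, b]%classic) => //.
  exact: subset_itv_oo_cc.
apply: continuous_compact_integrable; first exact: segment_compact.
by apply: continuous_subspaceT => y; exact: continuous_horner.
Qed.

Lemma integrable_mul_horner (f : R -> R) (P : {poly R}) :
  mu.-integrable I (EFin \o f) ->
  mu.-integrable I (EFin \o (fun y => f y * P.[y])).
Proof.
move=> If; have [B B0 hB] := poly_bounded_itv P.
have -> : EFin \o (fun y => f y * P.[y]) = ((EFin \o f) \* (EFin \o horner P))%E.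
  by apply/funext => y.
apply: integrableMl => //; first exact: measurable_poly.
exists B; split; first exact: num_real.
move=> x Bx y Iy /=; exact: le_trans (hB y Iy) (ltW Bx).
Qed.

(** A zero integral forces [P] to vanish outside a null set. A nonzero [P] has finitely many roots,
    so the cell would be covered by two null sets although its length [b - a] is positive. *)
Lemma horner_ge0_integral_eq0 (P : {poly R}) :
  (forall y, I y -> 0 <= P.[y]) -> \int[mu]_(y in I) P.[y] = 0 -> P = 0.
Proof.
move=> P0 IP; apply/eqP/negP => /negP Pn0.
have mP : measurable_fun I (EFin \o horner P).
  by apply/measurable_EFinP; exact: measurable_poly.
have : (\int[mu]_(y in I) `|(EFin \o horner P) y| = 0)%E.
  rewrite -[RHS]/((0 : R)%:E) -IP /Rintegral fineK; last first.
    exact: integrable_fin_num (integrable_horner P).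
  by apply: eq_integral => y /[!inE] Iy; rewrite /= ger0_norm // P0.
move/(ae_eq_integral_abs mu (measurable_itv _) mP) => [Z [mZ Z0 hZ]].
have ZP : I `<=` Z `|` [set y | root P y].
  move=> y Iy; have [Py|Py] := eqVneq P.[y] 0; first by right; apply/eqP.
  left; apply: hZ => /= /(_ Iy) [] /eqP; exact/negP.
have R0 : mu [set y | root P y] = 0%E.
  apply: countable_lebesgue_measure0; apply: finite_set_countable.
  apply: contrapT => /(infinite_set_fset (size P)) [B BP sB].
  have := @max_poly_roots _ P (finmap.enum_fset B) Pn0.
  rewrite finmap.fset_uniq => /(_ _ isT).
  rewrite ltnNge sB => H; suff: false by []. apply: H.
  by apply/allP => y yB; apply: BP.
have : (mu I <= mu Z + mu [set y | root P y])%E.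
  apply: (le_trans (le_outer_measure mu _ _ ZP)).
  exact: outer_measureU2.
rewrite Z0 R0 adde0 lebesgue_measure_itv /= lte_fin ab -EFinB lee_fin.
by rewrite leNgt subr_gt0 ab.
Qed.

End Interval.

(** * Integrability of the logarithm of a positive polynomial *)

Section LogLayer.
Local Open Scope classical_set_scope.
Variable R : realType.
Local Notation mu := (@lebesgue_measure R).

(* Layer cake: [|ln g|] exceeds a constant by at most the number of [k] with
   [g <= 2^-(k+1)]. *)
Lemma integrable_ln_sublevel (D : set R) (g : R -> R) (B : R) :
  measurable D -> (mu D < +oo)%E -> measurable_fun D g ->
  (forall y, D y -> 0 < g y <= B) ->
  (forall k, mu (D `&` [set y | (g y <= 1 / (2 ^ (k + 1))%:R)%R]) <=
             (1 / (2 ^ (k + 1))%:R)%:E)%E ->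
  mu.-integrable D (EFin \o (fun y => ln (g y))).
Proof.
move=> mD Dfin mg gB gl.
pose A k := D `&` [set y | (g y <= 1 / (2 ^ (k + 1))%:R)%R].
have mA k : measurable (A k).
  by have := mg mD `]-oo, (1 / (2 ^ (k + 1))%:R)]%classic (measurable_itv _).
pose phi (y : R) : \bar R := (\sum_(0 <= k <oo) (\1_(A k) y : R)%:E)%E.
have mI k : measurable_fun D (fun y => (\1_(A k) y : R)%:E).
  by apply/measurable_EFinP; exact: measurable_indic.
have i0 k y : (0 <= (\1_(A k) y : R)%:E)%E by rewrite lee_fin.
have phi0 y : (0 <= phi y)%E.
  by apply: nneseries_ge0 => k _ _; exact: i0.
(* The measures of the [A k] are bounded by the terms of 1/2 + 1/4 + ... = 1. *)
have Iphi : (\int[mu]_(y in D) phi y <= 1%:E)%E.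
  rewrite /phi integral_nneseries //.
  have := @cvg_geometric_eseries_half R 1 0.
  rewrite expr0 divr1 => /cvg_lim <- //.
  apply: lee_nneseries => k; first by move=> _ _; apply: integral_ge0 => *; exact: i0.
  move=> _; rewrite (integral_indic mu mD (mA k)).
  have -> : A k `&` D = A k by rewrite /A setIAC setIid.
  exact: gl.
have mphi : measurable_fun D phi.
  by apply: ge0_emeasurable_sum => // k _; exact: mI.
have mln : measurable_fun D (fun y => ln (g y)).
  by apply: measurableT_comp => //; exact: measurable_ln.
have le1 y : D y -> (`|(ln (g y))%:E| <= (`|B| + 1)%:E + phi y)%E.
  move=> Dy; have /andP[g0 gBy] := gB y Dy.
  have [g1|g1] := leP 1 (g y).
    rewrite gee0_abs ?lee_fin ?ln_ge0 //.
    apply: (@le_trans _ _ (`|B| + 1)%:E); last by rewrite leeDl.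
    rewrite lee_fin (le_trans (ltW (ln_sublinear g0))) // (le_trans gBy) //.
    by rewrite (le_trans (ler_norm B)) // lerDl.
  have L0 : ln (g y) < 0 by rewrite ln_lt0 // g0.
  set L := - ln (g y).
  have {}L0 : 0 <= L by rewrite /L oppr_ge0 ltW.
  have -> : (`|(ln (g y))%:E| = L%:E)%E by rewrite /= -normrN ger0_norm.
  (* For each [k < n] one has [k + 1 <= L], so [g y = expR (- L)] is at most [2^-(k+1)] because
     [2 <= expR 1]. Hence [phi y >= n], while [L < n + 1]. *)
  pose n := Num.truncn L.
  apply: (@le_trans _ _ (1 + n%:R)%:E).
    by rewrite lee_fin addrC natr1 ltW // truncnS_gt.
  rewrite EFinD; apply: leeD; first by rewrite lee_fin lerDr.
  apply: (@le_trans _ _ (\sum_(0 <= k < n) (\1_(A k) y)%:E)%E); last first.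
    by apply: nneseries_lim_ge => k _ _; exact: i0.
  rewrite (eq_big_nat _ _ (F2 := fun=> 1%:E)).
    by rewrite sumEFin big_const_nat subn0 iter_addr_0.
  move=> k /andP[_ kn]; congr EFin; rewrite indicE mem_set //.
  split => //=.
  have kL : (k + 1)%:R <= L.
    by have /andP[nL _] := truncn_itv L0; rewrite addn1 (le_trans _ nL) // ler_nat.
  rewrite -(@lnK _ (g y)) ?posrE // -[ln _]opprK -/L.
  rewrite (@le_trans _ _ (expR (- (k + 1)%:R))) ?ler_expR ?lerN2 //.
  rewrite expRN div1r lef_pV2 ?posrE ?expR_gt0 ?ltr0n ?expn_gt0 //.
  rewrite -[(k + 1)%:R]mulr1 expRM_natl natrX lerXn2r ?nnegrE ?expR_ge0 //.
  by have := expR_ge1Dx (1 : R); rewrite -[2%:R]natr1.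
apply/integrableP; split; first exact/measurable_EFinP.
apply: (@le_lt_trans _ _ (\int[mu]_(y in D) ((`|B| + 1)%:E + phi y))%E).
  apply: ge0_le_integral => //.
  - by apply: measurableT_comp => //; exact/measurable_EFinP.
  - by apply: emeasurable_funD.
rewrite ge0_integralD //.
rewrite integral_cst // lte_add_pinfty //.
  by rewrite lte_mul_pinfty // lee_fin addr_ge0.
exact: le_lt_trans Iphi (ltry _).
Qed.

End LogLayer.

Section LogPoly.
Local Open Scope classical_set_scope.
Variables (R : realType) (a b : R).
Hypothesis ab : a < b.
Local Notation mu := (@lebesgue_measure R).
Local Notation I := (`]a, b[%classic : set R).

Lemma horner_endpoints_ge0 (P : {poly R}) :
  (forall y, I y -> 0 < P.[y]) -> 0 <= P.[a] /\ 0 <= P.[b].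
Proof.
move=> P0; have cP : continuous (horner P) by exact: continuous_horner.
split.
  have ca : P.[y] @[y --> a^'+] --> P.[a].
    exact: (cvg_at_right_filter (cP a)).
  apply: (cvgr_to_ge ca); near=> y; apply/ltW/P0; rewrite /= in_itv /=.
  by apply/andP; split; near: y; [exact: nbhs_right_gt|exact: nbhs_right_lt].
have cb : P.[y] @[y --> b^'-] --> P.[b].
  exact: (cvg_at_left_filter (cP b)).
apply: (cvgr_to_ge cb); near=> y; apply/ltW/P0; rewrite /= in_itv /=.
by apply/andP; split; near: y; [exact: nbhs_left_gt|exact: nbhs_left_lt].
Unshelve. all: by end_near. Qed.

Let mI : measurable I. Proof. exact: measurable_itv. Qed.

Let muI : (mu I < +oo)%E.
Proof. by rewrite lebesgue_measure_itv /= lte_fin ab -EFinB ltry. Qed.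

Lemma mu_oc_le (c d e : R) : d - c = e -> 0 <= e ->
  (mu `]c, d] <= e%:E)%E /\ (mu `[c, d[ <= e%:E)%E.
Proof.
move=> <- cd; rewrite !lebesgue_measure_itv /= lte_fin.
by case: ifP => _; split; rewrite -?EFinB ?lee_fin.
Qed.

Lemma integrable_ln_subl : mu.-integrable I (EFin \o (fun y => ln (y - a))).
Proof.
apply: (@integrable_ln_sublevel _ _ _ (b - a)) => //.
- by apply: measurable_funB => //; exact: measurable_id.
- by move=> y; rewrite /= in_itv /= => /andP[ay yb]; rewrite subr_gt0 ay lerD2r ltW.
- move=> k; set e := (1 / _); have e0 : 0 <= e by rewrite divr_ge0.
  have sub : I `&` [set y | y - a <= e] `<=` `]a, (a + e)].
    by move=> y [/=]; rewrite !in_itv /= => /andP[-> _] /=; rewrite lerBlDl.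
  apply: (le_trans (le_outer_measure mu _ _ sub)).
  by apply: (mu_oc_le _ e0).1; rewrite addrC addKr.
Qed.

Lemma integrable_ln_subr : mu.-integrable I (EFin \o (fun y => ln (b - y))).
Proof.
apply: (@integrable_ln_sublevel _ _ _ (b - a)) => //.
- by apply: measurable_funB => //; exact: measurable_id.
- by move=> y; rewrite /= in_itv /= => /andP[ay yb]; rewrite subr_gt0 yb lerD2l lerN2 ltW.
- move=> k; set e := (1 / _); have e0 : 0 <= e by rewrite divr_ge0.
  have sub : I `&` [set y | b - y <= e] `<=` `[(b - e), b[.
    by move=> y [/=]; rewrite !in_itv /= => /andP[_ ->] /=; rewrite andbT lerBlDr lerBlDl addrC.
  apply: (le_trans (le_outer_measure mu _ _ sub)).
  by apply: (mu_oc_le _ e0).2; rewrite opprB addrC subrK.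
Qed.

(** Induction on the size: a root at an end of the cell is factored out and contributes [ln (y - a)]
    or [ln (b - y)]. Without such a root [P] is positive on the closed interval and [ln P] is
    continuous there. *)
Lemma integrable_ln_horner (P : {poly R}) :
  (forall y, I y -> 0 < P.[y]) ->
  mu.-integrable I (EFin \o (fun y => ln P.[y])).
Proof.
have [n] := ubnP (size P); elim: n P => // n IH P /ltnSE sP P0.
have Pn0 : P != 0.
  apply/eqP => PE; have := P0 ((a + b) / 2).
  by rewrite PE horner0 ltxx /= in_itv /= !midf_lt // => /(_ isT).
have [/factor_theorem[Q PQ]|Pa] := boolP (root P a).
  have Q0 y : I y -> 0 < Q.[y].
    move=> Iy; have := P0 y Iy; rewrite PQ hornerM hornerXsubC pmulr_lgt0 //.
    by move: Iy; rewrite /= in_itv /= subr_gt0 => /andP[].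
  have sQ : (size Q < n)%N.
    apply: leq_trans sP; rewrite PQ size_Mmonic ?monicXsubC ?size_XsubC ?addn2 //.
    by apply: contraNneq Pn0 => Q00; rewrite PQ Q00 mul0r.
  have := @integrableD _ _ _ mu I mI _ _ (IH _ sQ Q0) integrable_ln_subl.
  apply: eq_integrable => // y /[!inE] Iy /=; rewrite -EFinD PQ hornerM hornerXsubC lnM //.
    by rewrite posrE Q0.
  by move: Iy; rewrite posrE /= in_itv /= subr_gt0 => /andP[].
have [/factor_theorem[Q PQ]|Pb] := boolP (root P b).
  have PQ' y : P.[y] = (- Q).[y] * (b - y).
    by rewrite PQ hornerM hornerXsubC hornerN mulNr -mulrN opprB.
  have Q0 y : I y -> 0 < (- Q).[y].
    move=> Iy; have := P0 y Iy; rewrite PQ' pmulr_lgt0 //.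
    by move: Iy; rewrite /= in_itv /= subr_gt0 => /andP[].
  have sQ : (size (- Q) < n)%N.
    apply: leq_trans sP; rewrite size_polyN PQ size_Mmonic ?monicXsubC ?size_XsubC ?addn2 //.
    by apply: contraNneq Pn0 => Q00; rewrite PQ Q00 mul0r.
  have := @integrableD _ _ _ mu I mI _ _ (IH _ sQ Q0) integrable_ln_subr.
  apply: eq_integrable => // y /[!inE] Iy /=; rewrite -EFinD PQ' lnM //.
    by rewrite posrE Q0.
  by move: Iy; rewrite posrE /= in_itv /= subr_gt0 => /andP[].
have [Pa0 Pb0] := horner_endpoints_ge0 P0.
have Pc y : `[a, b]%classic y -> 0 < P.[y].
  rewrite /= in_itv /= => /andP[]; rewrite le_eqVlt => /predU1P[<- _|ay].
    by rewrite lt_def Pa0 andbT.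
  rewrite le_eqVlt => /predU1P[->|yb]; first by rewrite lt_def Pb0 andbT.
  by apply: P0; rewrite /= in_itv /= ay.
apply: (@integrableS _ _ _ mu `[a, b]%classic) => //.
  exact: subset_itv_oo_cc.
apply: continuous_compact_integrable; first exact: segment_compact.
apply: continuous_in_subspaceT => y /[!inE] yab.
apply: continuous_comp; first exact: continuous_horner.
exact/continuous_ln/Pc.
Qed.

End LogPoly.

(** * First variation of the entropy *)

Section EntropyPointwise.
Variable R : realType.
Implicit Types x y t g : R.

Lemma ln_ge_subV x : 0 < x -> - x^-1 <= ln x.
Proof.
move=> x0; rewrite -[ln x]opprK -lnV ?posrE // lerN2.
by rewrite ltW // ln_sublinear // invr_gt0.
Qed.

Lemma ln_le_tangent x y : 0 < x -> 0 < y -> ln y <= ln x + (y - x) / x.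
Proof.
move=> x0 y0; rewrite -lerBlDl -ln_div ?posrE //.
have -> : y / x = 1 + (y - x) / x by field; rewrite gt_eqF.
by apply: le_ln1Dx; rewrite mulrBl divff ?gt_eqF // ltrBrDl subrr divr_gt0.
Qed.

(** For [x <= 0] the left side is 0. No sign condition is imposed on [x], so that the bound also
    serves the new concentrations, which may fail to be positive. *)
Lemma normr_xlnx_le x : `|x * ln x| <= 1 + x ^+ 2.
Proof.
have [x0|x0] := leP x 0; first by rewrite ln0 // mulr0 normr0 addr_ge0 ?sqr_ge0.
rewrite ler_norml; apply/andP; split.
  apply: (@le_trans _ _ (-1)); first by rewrite lerN2 lerDl sqr_ge0.
  by have := ler_wpM2l (ltW x0) (ln_ge_subV x0); rewrite mulrN divff ?gt_eqF.
apply: (@le_trans _ _ (x ^+ 2)); last by rewrite lerDr.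
by rewrite expr2 ler_wpM2l ?ltW // ln_sublinear.
Qed.

(* The first argument of [Num.min] vanishes with [t], the second one stays
   integrable when [x] is a polynomial with zeros at the ends of a cell.  Where
   [x + t * g <= 0] the left-hand side is [0], since [ln] is then [0]. *)
Lemma xlnx_increment x t g : 0 < x -> 0 < t <= 1 ->
  (x + t * g) * ln (x + t * g) <=
  x * ln x + t * ((ln x + 1) * g) +
  t * Num.min (t * (g ^+ 2 * (1 + x) / x))
              (`|g| * (1 + x + `|g| + `|ln x|)).
Proof.
move=> x0 /andP[t0 t1]; set y := x + t * g.
suff [H1 H2] : y * ln y - x * ln x - t * ((ln x + 1) * g) <=
    t * (t * (g ^+ 2 * (1 + x) / x)) /\
    y * ln y - x * ln x - t * ((ln x + 1) * g) <=
    t * (`|g| * (1 + x + `|g| + `|ln x|)).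
  by rewrite -lerBlDl opprD addrA /Order.min; case: ifP.
have xn0 : x != 0 by rewrite gt_eqF.
have q0 : 0 <= t * (t * g ^+ 2) / x.
  by apply: divr_ge0; [apply: mulr_ge0; [|apply: mulr_ge0; [|exact: sqr_ge0]]|]; exact: ltW.
have yE : y - x = t * g by rewrite /y addrC addKr.
have [y0|y0] := leP y 0.
  rewrite (ln0 y0) mulr0.
  have g0 : g < 0.
    by rewrite ltNge; apply/negP => g0; move: y0; rewrite /y leNgt ltr_wpDr // mulr_ge0 // ltW.
  have -> : 0 - x * ln x - t * ((ln x + 1) * g) = - y * ln x + t * - g.
    by rewrite /y; ring.
  have lx := ltW (ln_sublinear x0).
  have tg : - y <= t * - g by rewrite /y; nra.
  have ng : 0 <= t * - g by rewrite mulr_ge0 ?ltW // oppr_gt0.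
  split.
    apply: (@le_trans _ _ (t * - g * (1 + x))).
      rewrite mulrDr mulr1 addrC lerD2l.
      apply: (@le_trans _ _ (- y * x)); first by rewrite ler_wpM2l // oppr_ge0.
      by rewrite ler_wpM2r // ltW.
    (* The last factor is at least 1, since [y <= 0] means [x <= t * - g]. *)
    have -> : t * (t * (g ^+ 2 * (1 + x) / x)) = (t * - g) * (1 + x) * (t * - g / x).
      by field.
    apply: ler_peMr; first by apply: mulr_ge0 => //; rewrite addr_ge0 // ltW.
    by rewrite ler_pdivlMr // mul1r; move: y0; rewrite /y; lra.
  rewrite ltr0_norm //.
  apply: (@le_trans _ _ (t * - g * (1 + `|ln x|))).
    rewrite mulrDr mulr1 addrC lerD2l.
    apply: (@le_trans _ _ (- y * `|ln x|)).
      by rewrite ler_wpM2l ?ler_norm // oppr_ge0.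
    by rewrite ler_wpM2r.
  rewrite -mulrA ler_wpM2l ?(ltW t0) // ler_wpM2l ?oppr_ge0 ?(ltW g0) //.
  by rewrite lerD2r -addrA lerDl addr_ge0 ?(ltW x0) // oppr_ge0 ltW.
(* By concavity [ln y] lies below its tangent at [x], which leaves at most [t^2 g^2 / x] beyond the
   first variation. *)
have lyx := ln_le_tangent x0 y0; rewrite yE in lyx.
have ylx : y * ln x = x * ln x + t * g * ln x by rewrite /y; ring.
have tE : t * ((ln x + 1) * g) = t * g * ln x + t * g by ring.
have yly : y * ln y <= y * ln x + y * (t * g / x).
  by rewrite -mulrDr ler_wpM2l // ltW.
split.
  have -> : t * (t * (g ^+ 2 * (1 + x) / x)) = t * (t * g ^+ 2) / x * (1 + x) by field.
  have : t * (t * g ^+ 2) / x <= t * (t * g ^+ 2) / x * (1 + x).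
    by apply: ler_peMr => //; rewrite lerDl ltW.
  have : y * (t * g / x) = t * g + t * (t * g ^+ 2) / x by rewrite /y; field.
  by set q := t * (t * _) / x; set q' := q * _; lra.
(* The second bound must be free of [1 / x]: for [g <= 0] the term [y * (t * g / x)] is dropped by
   its sign, and for [g > 0] the factor [x] in [x * (ln y - ln x) <= t * g] cancels the
   denominator. *)
have [g0|g0] := leP g 0.
  have : y * (t * g / x) <= 0.
    by rewrite pmulr_rle0 // pmulr_lle0 ?invr_gt0 // pmulr_rle0.
  have : t * - g <= t * (- g * (1 + x + - g + `|ln x|)).
    rewrite ler_pM2l //; apply: ler_peMr; first by rewrite oppr_ge0.
    by rewrite -!addrA lerDl !addr_ge0 ?oppr_ge0 // ltW.
  rewrite tE (ler0_norm g0); set q := t * (- g * _); lra.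
have lxy : ln x <= ln y by rewrite ler_ln ?posrE // lerDl mulr_ge0 // ltW.
rewrite (gtr0_norm g0).
have h1 : x * (ln y - ln x) <= t * g.
  have := ler_wpM2l (ltW x0) lyx.
  by rewrite mulrDr [x * (_ / _)]mulrC divfK // mulrBr lerBlDl.
have h2 : ln y <= x + g.
  apply: (le_trans (ltW (ln_sublinear y0))).
  by rewrite /y lerD2l ler_piMl // ltW.
have h3 : ln y - ln x <= 1 + x + g + `|ln x|.
  have := ler_norm (- ln x); rewrite normrN; lra.
have := ler_wpM2l (ltW t0) (ler_wpM2l (ltW g0) h3).
have : y * ln y = x * ln y + t * g * ln y by rewrite /y; ring.
move=> ->; rewrite mulrBr in h1; nra.
Qed.

End EntropyPointwise.

Section EntropyIntegral.
Local Open Scope classical_set_scope.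
Variables (R : realType) (a b : R).
Hypothesis ab : a < b.
Local Notation mu := (@lebesgue_measure R).
Local Notation I := (`]a, b[%classic : set R).

Let mI : measurable I. Proof. exact: measurable_itv. Qed.

Let muI : (mu I < +oo)%E.
Proof. by rewrite lebesgue_measure_itv /= lte_fin ab -EFinB ltry. Qed.

Lemma integrable_addr (f g : R -> R) :
  mu.-integrable I (EFin \o f) -> mu.-integrable I (EFin \o g) ->
  mu.-integrable I (EFin \o (fun y => f y + g y)).
Proof. by move=> If Ig; exact: (@integrableD _ _ _ mu I mI _ _ If Ig). Qed.

Lemma integrable_mull (c : R) (f : R -> R) :
  mu.-integrable I (EFin \o f) -> mu.-integrable I (EFin \o (fun y => c * f y)).
Proof. by move=> If; exact: (@integrableZl _ _ _ mu I mI c _ If). Qed.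

Lemma integrable_xlnx (P : {poly R}) :
  mu.-integrable I (EFin \o (fun y => P.[y] * ln P.[y])).
Proof.
have [B B0 hB] := poly_bounded_itv a b P.
apply: (@measurable_bounded_integrable _ _ _ mu _ I mI muI).
- apply: measurable_funM; first exact: measurable_poly.
  by apply: measurableT_comp; [exact: measurable_ln|exact: measurable_poly].
- exists (1 + B ^+ 2); split; first exact: num_real.
  move=> x Bx y Iy; apply/ltW/(le_lt_trans _ Bx).
  apply: (le_trans (normr_xlnx_le _)).
  by rewrite lerD2l -real_normK ?num_real // lerXn2r ?nnegrE ?(ltW B0) // hB.
Qed.

(** The pointwise error tends to 0 with [t] and is dominated by a multiple of [1 + |ln C|], which is
    integrable; dominated convergence makes its integral smaller than [eps]. *)
Lemma entropy_increment (C G : {poly R}) (eps : R) :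
  (forall y, I y -> 0 < C.[y]) -> 0 < eps ->
  exists2 tau : R, 0 < tau & forall t, 0 < t < tau ->
    \int[mu]_(y in I) ((C + t *: G).[y] * ln (C + t *: G).[y])
    - \int[mu]_(y in I) (C.[y] * ln C.[y]) <=
    t * (\int[mu]_(y in I) (ln C.[y] * G.[y]) + \int[mu]_(y in I) G.[y] + eps).
Proof.
move=> C0 eps0.
(* The real power is measurable on the whole line and equals the inverse where [C] is positive. *)
pose A y := G.[y] ^+ 2 * (1 + C.[y]) * (C.[y] `^ (-1)).
pose Dm y := `|G.[y]| * (1 + C.[y] + `|G.[y]| + `|ln C.[y]|).
(* The error at time [1 / (n + 1)]. It bounds the error at every smaller [t], so a single index [n]
   will give the threshold. *)
pose H n y := Num.min (n.+1%:R^-1 * A y) (Dm y).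
have mG : measurable_fun I (horner G) by exact: measurable_poly.
have mC : measurable_fun I (horner C) by exact: measurable_poly.
have mlnC : measurable_fun I (fun y => ln C.[y]).
  by apply: measurableT_comp => //; exact: measurable_ln.
have ilnC := integrable_ln_horner ab C0.
have mA : measurable_fun I A.
  apply: measurable_funM.
    apply: measurable_funM; first exact: (measurable_funX 2 mG).
    exact: (measurable_funD (measurable_cst _) mC).
  exact: (measurableT_comp (measurable_powR (-1)) mC).
have mDm : measurable_fun I Dm.
  have mnG := measurableT_comp (@normr_measurable R setT) mG.
  apply: (measurable_funM mnG).
  apply: measurable_funD; last exact: (measurableT_comp (@normr_measurable R setT) mlnC).
  by apply: measurable_funD mnG; exact: (measurable_funD (measurable_cst _) mC).
have mH n : measurable_fun I (H n).
  exact: (measurable_minr (measurable_funM (measurable_cst _) mA) mDm).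
have A0 y : I y -> 0 <= A y.
  move=> Iy; apply: mulr_ge0; last exact: powR_ge0.
  apply: mulr_ge0; first exact: sqr_ge0.
  by rewrite addr_ge0 // ltW // C0.
have Dm0 y : I y -> 0 <= Dm y.
  by move=> Iy; rewrite /Dm mulr_ge0 // !addr_ge0 // ltW // C0.
have H0 n y : I y -> 0 <= H n y.
  by move=> Iy; rewrite /H le_min mulr_ge0 ?A0 ?Dm0.
have HD n y : H n y <= Dm y by rewrite /H ge_min lexx orbT.
have iDm : mu.-integrable I (EFin \o Dm).
  have [B B0 hB] := poly_bounded_itv a b G.
  have [B' B'0 hB'] := poly_bounded_itv a b C.
  have := @integrableZl _ _ _ mu I mI B _ (@integrableD _ _ _ mu I mI _ _
     (integrable_norm ilnC) (integrable_horner a b (1 + B' + B)%:P)).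
  apply: le_integrable => //; first exact/measurable_EFinP.
  move=> y Iy; rewrite lee_fin /= [leLHS]ger0_norm ?Dm0 // hornerC.
  rewrite [leRHS]ger0_norm; last by rewrite mulr_ge0 ?(ltW B0) // !addr_ge0 ?(ltW B0) ?(ltW B'0).
  apply: ler_pM => //; first by rewrite !addr_ge0 // ltW // C0.
    exact: hB.
  have := hB y Iy; have := le_trans (ler_norm _) (hB' y Iy); lra.
have iH n : mu.-integrable I (EFin \o H n).
  apply: le_integrable iDm => //; first exact: ((measurable_EFinP _ _).2 (mH n)).
  by move=> y Iy; rewrite /= lee_fin (ger0_norm (H0 n y Iy)) (ger0_norm (Dm0 y Iy)).
have cvgH y : I y -> (EFin \o H n) y @[n --> \oo] --> (cst 0%:E y : \bar R).
  move=> Iy; apply: cvg_EFin; first exact: nearW.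
  apply: (@squeeze_cvgr _ _ _ _ (cst 0) (fun n => n.+1%:R^-1 * A y)).
  - by apply: nearW => n; rewrite /= H0 //= /H ge_min lexx.
  - exact: cvg_cst.
  - by rewrite -[X in _ --> X](mul0r (A y)); apply: cvgMr_tmp; exact: cvg_harmonic.
have [||||| _ _ limH] := @dominated_convergence _ _ _ mu I mI
   (fun n => EFin \o H n) (cst 0%:E) (EFin \o Dm).
- by move=> n; exact: ((measurable_EFinP _ _).2 (mH n)).
- exact: measurable_cst.
- by apply: aeW => y; exact: cvgH.
- exact: iDm.
- by apply: aeW => y n Iy; rewrite /= lee_fin (ger0_norm (H0 n y Iy)).
have {}limH : \int[mu]_(y in I) H n y @[n --> \oo] --> (0 : R).
  apply: fine_cvg; rewrite (_ : 0%:E = \int[mu]_(y in I) cst 0%:E y)%E //.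
  by rewrite integral0.
have [n _ /(_ n (leqnn n)) /= Hn] := cvgr_lt _ limH _ eps0.
exists n.+1%:R^-1; first by rewrite invr_gt0.
move=> t /andP[t0 tn].
have iG := integrable_horner a b G.
have iX := integrable_xlnx.
have iL := integrable_mul_horner G ilnC.
set PE := C + t *: G.
have step : \int[mu]_(y in I) (PE.[y] * ln PE.[y]) <=
    \int[mu]_(y in I) (C.[y] * ln C.[y] + t * (ln C.[y] * G.[y] + G.[y] + H n y)).
  apply: (@le_Rintegral _ _ _ mu I _ _ mI (iX PE)).
  - apply: (integrable_addr (iX C)); apply: integrable_mull.
    by apply: integrable_addr (iH n); exact: integrable_addr.
  - move=> y Iy; rewrite /PE !hornerE.
    have t1 : 0 < t <= 1.
      by rewrite t0 (le_trans (ltW tn)) // invf_le1 // ler1n.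
    apply: (le_trans (xlnx_increment G.[y] (C0 y Iy) t1)).
    rewrite -addrA lerD2l -mulrDr ler_pM2l // mulrDl mul1r lerD2l.
    rewrite /H le_min !ge_min lexx orbT andbT; apply/orP; left.
    have Cy := ltW (C0 y Iy); rewrite /A (powR_inv1 Cy).
    apply: ler_wpM2r; last exact: ltW.
    by rewrite -(powR_inv1 Cy); exact: A0.
rewrite lerBlDl (le_trans step) //.
have iLG := integrable_addr iL iG; have iLGH := integrable_addr iLG (iH n).
rewrite (@RintegralD _ _ _ mu I _ _ mI (iX C) (integrable_mull t iLGH)) lerD2l.
rewrite (@RintegralZl _ _ _ mu I _ _ mI iLGH) ler_pM2l //.
by rewrite (@RintegralD _ _ _ mu I _ _ mI iLG (iH n)) (@RintegralD _ _ _ mu I _ _ mI iL iG) lerD2l ltW.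
Qed.

End EntropyIntegral.

(** * Weighted inner products of polynomials *)

(** The argument is a polynomial rather than a function, which makes the integral a linear form on
    [{poly R}] without side conditions. *)
Definition poly_int (R : realType) (a b : R) (P : {poly R}) : R :=
  \int[@lebesgue_measure R]_(y in `]a, b[%classic) P.[y].

Section PolyInt.
Local Open Scope classical_set_scope.
Variables (R : realType) (a b : R).
Local Notation mu := (@lebesgue_measure R).
Local Notation I := (`]a, b[%classic : set R).
Local Notation pint := (@poly_int R a b).

Lemma poly_int_is_linear : linear_for *%R pint.
Proof.
move=> c P Q; rewrite /poly_int.
have mI : measurable I by exact: measurable_itv.
have iP := integrable_horner a b P; have iQ := integrable_horner a b Q.
rewrite -(@RintegralZl _ _ _ mu I _ _ mI iP).
rewrite -(@RintegralD _ _ _ mu I _ _ mI (integrable_mull c iP) iQ).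
by apply: eq_Rintegral => y _; rewrite !hornerE.
Qed.

HB.instance Definition _ :=
  GRing.isLinear.Build R {poly R} R *%R pint poly_int_is_linear.

Lemma poly_intZ (c : R) (P : {poly R}) : pint (c *: P) = c * pint P.
Proof. exact: linearZ. Qed.

Hypothesis ab : a < b.

Lemma poly_int_ge0 (P : {poly R}) : (forall y, I y -> 0 <= P.[y]) -> 0 <= pint P.
Proof. by move=> P0; exact: (@Rintegral_ge0 _ _ _ mu I _ P0). Qed.

Section Weight.
Variable M : {poly R}.
Hypothesis M0 : forall y, I y -> 0 < M.[y].

Lemma weighted_sqr_ge0 (w : {poly R}) : 0 <= pint (M * w * w).
Proof.
apply: poly_int_ge0 => y Iy; rewrite -mulrA !hornerM -expr2.
by rewrite mulr_ge0 ?sqr_ge0 // ltW // M0.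
Qed.

Lemma weighted_sqr_eq0 (w : {poly R}) : pint (M * w * w) = 0 -> w = 0.
Proof.
move=> w0; have Mww : M * w * w = 0.
  apply: (horner_ge0_integral_eq0 ab) w0 => y Iy; rewrite -mulrA !hornerM -expr2.
  by rewrite mulr_ge0 ?sqr_ge0 // ltW // M0.
have Mn0 : M != 0.
  apply/eqP => ME; have := @M0 ((a + b) / 2).
  by rewrite ME horner0 ltxx /= in_itv /= !midf_lt // => /(_ isT).
by move: Mww; rewrite -mulrA => /eqP; rewrite !mulf_eq0 (negPf Mn0) orbb => /eqP.
Qed.

(* The Gram matrix of the monomials is invertible because the weighted form is
   definite. *)
Lemma weighted_riesz (n : nat) (l : {poly R} -> R) :
  linear_for *%R l ->
  exists r, forall w : {poly R}, (size w <= n)%N -> pint (M * w * r) = l w.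
Proof.
move=> llin.
pose L : {linear {poly R} -> R | *%R} :=
  HB.pack l (GRing.isLinear.Build R {poly R} R *%R l llin).
pose pv (v : 'rV[R]_n) : {poly R} := \sum_(i < n) v 0 i *: 'X^i.
pose Gm : 'M[R]_n := \matrix_(i, j) pint (M * 'X^i * 'X^j).
have GmE (v : 'rV[R]_n) (u : 'I_n) : (v *m Gm) 0 u = pint (M * pv v * 'X^u).
  rewrite mxE /pv mulr_sumr mulr_suml linear_sum; apply: eq_bigr => i _.
  by rewrite mxE -scalerAr -scalerAl linearZ.
have Gu : Gm \in unitmx.
  rewrite -row_free_unit -kermx_eq0; apply/rowV0P => v /sub_kermxP vG.
  have pv0 : pv v = 0.
    apply: weighted_sqr_eq0; rewrite {2}/pv mulr_sumr linear_sum big1 // => i _.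
    by rewrite -scalerAr linearZ /= -GmE vG mxE mulr0.
  apply/rowP => i; rewrite mxE; have := congr1 (fun p : {poly R} => p`_i) pv0.
  rewrite /pv coef_sum coef0 (bigD1 i) //= coefZ coefXn eqxx mulr1 big1 ?addr0 //.
  move=> j ji; rewrite coefZ coefXn eq_sym [_ == _](_ : _ = (j == i)) //.
  by rewrite (negPf ji) mulr0.
pose c := (\row_i l 'X^i) *m invmx Gm.
have rE (u : 'I_n) : pint (M * 'X^u * pv c) = l 'X^u.
  by rewrite mulrAC -GmE /c mulmxKV // mxE.
exists (pv c) => w sw; move: (pv c) rE => r rE.
have -> : w = \sum_(i < n) w`_i *: 'X^i.
  rewrite -poly_def; apply/polyP => i; rewrite coef_poly.
  by case: ltnP => // ni; rewrite nth_default // (leq_trans sw).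
rewrite -[l]/(L : _ -> _) linear_sum mulr_sumr mulr_suml linear_sum.
apply: eq_bigr => i _; rewrite -scalerAr -scalerAl !linearZ /=; congr (_ * _).
exact: rE.
Qed.

(* A Peter-Paul inequality, obtained by expanding [M (w / 2 + s r)^2 >= 0] for
   the representer [r] of [l]. *)
Lemma weighted_trace (n : nat) (l : {poly R} -> R) :
  linear_for *%R l ->
  exists K, forall (w : {poly R}) (s : R), (size w <= n)%N ->
    - (s * l w) <= 4%:R^-1 * pint (M * w * w) + s ^+ 2 * K.
Proof.
move=> /(weighted_riesz n)[r hr]; exists (pint (M * r * r)) => w s sw.
have H := weighted_sqr_ge0 (2%:R^-1 *: w + s *: r).
have E : M * (2%:R^-1 *: w + s *: r) * (2%:R^-1 *: w + s *: r) =
  4%:R^-1 *: (M * w * w) + s *: (M * w * r) + (s ^+ 2) *: (M * r * r).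
  rewrite -!mul_polyC; set h := (2%:R^-1)%:P; set u := s%:P.
  have -> : (4%:R^-1)%:P = h * h :> {poly R} by rewrite -polyCM; congr (_%:P); field.
  have hh : h + h = 1 by rewrite /h -polyCD; congr (_%:P); field.
  rewrite rmorphXn /= -/u -[u * (M * w * r)]mul1r -hh; ring.
rewrite E !linearD !linearZ /= hr // in H; lra.
Qed.

End Weight.
End PolyInt.

(** * The bilinear forms of the scheme *)

(** One operation covers scaling, sums and differences: [blin (-1) u v] is [v - u]. *)
Definition blin (R : realType) (s : R) (u v : broken R) : broken R :=
  fun j => s *: u j + v j.

Section DGForms.
Variables (R : realType) (Mh : mesh R).
Local Notation N := (ncell Mh).
Local Notation x := (node Mh).
Local Notation h := (hx Mh).
Local Notation cint j := (poly_int (node Mh j) (node Mh j.+1)).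
Local Notation jump := (jump Mh).
Local Notation avg := (avg Mh).
Local Notation Fl := (Fl Mh).
Local Notation AM := (AM Mh).
Implicit Types (u v w M : broken R) (P : flux_param R) (s : R).

Lemma cell_int_horner j (f : R -> R) (p : {poly R}) :
  (forall y, f y = p.[y]) -> cell_int Mh j f = cint j p.
Proof. by move=> fp; apply: eq_Rintegral => y _; exact: fp. Qed.

Lemma in_Vh_blin k s u v :
  in_Vh Mh k u -> in_Vh Mh k v -> in_Vh Mh k (blin s u v).
Proof.
move=> Vu Vv j jN; rewrite (leq_trans (size_polyD _ _)) // geq_max Vv // andbT.
by rewrite (leq_trans (size_scale_leq _ _)) // Vu.
Qed.

Lemma dx_blin s u v : dx (blin s u v) = blin s (dx u) (dx v).
Proof. by apply/funext => j; rewrite /dx /blin derivD derivZ. Qed.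

Lemma jump_blin s u v i : jump (blin s u v) i = s * jump u i + jump v i.
Proof. by rewrite /Defs.jump /blin !(hornerD, hornerZ); ring. Qed.

Lemma avg_blin s u v i : avg (blin s u v) i = s * avg u i + avg v i.
Proof. by rewrite /Defs.avg /blin; case: ifP => _; [|case: ifP => _]; rewrite !(hornerD, hornerZ) //; field. Qed.

Lemma Fl_blin P s u v i : Fl P (blin s u v) i = s * Fl P u i + Fl P v i.
Proof. by rewrite /Defs.Fl !dx_blin !jump_blin avg_blin; ring. Qed.

(** Polynomials indexed beyond the last cell are arbitrary, so broken polynomials are compared cell
    by cell instead of by equality. *)
Lemma jump_ext u v i : (0 < i < N)%N -> (forall j, (j < N)%N -> u j = v j) ->
  jump u i = jump v i.
Proof.
by move=> /andP[i0 iN] uv; rewrite /Defs.jump !uv // (leq_ltn_trans (leq_pred i)).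
Qed.

Lemma avg_ext u v i : (0 < i < N)%N -> (forall j, (j < N)%N -> u j = v j) ->
  avg u i = avg v i.
Proof.
move=> /andP[i0 iN] uv; have N0 := ncell_gt0 Mh.
rewrite /Defs.avg (uv 0%N) // (uv N.-1) ?ltn_predL // (uv i) // (uv i.-1) //.
exact: leq_ltn_trans (leq_pred i) iN.
Qed.

Lemma avg_interior u i : (0 < i < N)%N ->
  avg u i = ((u i).[x i] + (u i.-1).[x i]) / 2%:R.
Proof. by move=> /andP[i0 iN]; rewrite /Defs.avg gtn_eqF // ltn_eqF. Qed.

Lemma AME P M u v : AM P M u v =
  \sum_(0 <= j < N) cint j (M j * dx u j * dx v j) +
  \sum_(1 <= i < N) avg M i * (Fl P u i * jump v i + avg (dx v) i * jump u i).
Proof.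
congr (_ + _); apply: eq_bigr => j _; apply: cell_int_horner => y.
by rewrite !hornerM.
Qed.

Lemma AM_blinl P M s u u' v :
  AM P M (blin s u u') v = s * AM P M u v + AM P M u' v.
Proof.
rewrite !AME mulrDr !mulr_sumr addrACA -!big_split /=.
congr (_ + _); apply: eq_bigr => i _; last by rewrite Fl_blin jump_blin; ring.
by rewrite dx_blin /blin -poly_int_is_linear mulrDr mulrDl -scalerAr -scalerAl.
Qed.

Lemma AM_blinr P M s u v v' :
  AM P M u (blin s v v') = s * AM P M u v + AM P M u v'.
Proof.
rewrite !AME mulrDr !mulr_sumr addrACA -!big_split /=.
congr (_ + _); apply: eq_bigr => i _; last by rewrite dx_blin avg_blin jump_blin; ring.
by rewrite dx_blin /blin -poly_int_is_linear mulrDr -scalerAr.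
Qed.

(** Without the second-derivative jumps the interface term is [{M}] times [beta0 / h [u][v] +
    {u'}[v] + {v'}[u]]. *)
Lemma AM_sym P M u v : beta1 P = 0 -> AM P M u v = AM P M v u.
Proof.
move=> b1; rewrite !AME; congr (_ + _); apply: eq_bigr => i _.
  by rewrite mulrAC.
by rewrite /Defs.Fl b1; ring.
Qed.

Lemma AM_ext P M M' u u' v v' :
  (forall j, (j < N)%N -> M j = M' j) -> (forall j, (j < N)%N -> u j = u' j) ->
  (forall j, (j < N)%N -> v j = v' j) -> AM P M u v = AM P M' u' v'.
Proof.
move=> MM uu vv.
have duu j : (j < N)%N -> dx u j = dx u' j by move=> jN; rewrite /dx uu.
have dvv j : (j < N)%N -> dx v j = dx v' j by move=> jN; rewrite /dx vv.
have dduu j : (j < N)%N -> dx (dx u) j = dx (dx u') j.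
  by move=> jN; rewrite /dx uu.
rewrite !AME; congr (_ + _); apply: eq_big_nat => i hi.
  by rewrite MM ?duu ?dvv //; case/andP: hi.
by rewrite /Defs.Fl (avg_ext hi MM) (jump_ext hi uu) (jump_ext hi vv)
  (avg_ext hi dvv) (avg_ext hi duu) (jump_ext hi dduu).
Qed.

(** These functions form the kernel of the form on both sides. The jump is weighted by [avg M],
    because [M] may vanish from both sides at an interface and coercivity then gives no control of
    the jump there. *)
Lemma AM_flat P M u :
  (forall j, (j < N)%N -> dx u j = 0) ->
  (forall i, (0 < i < N)%N -> avg M i * jump u i = 0) ->
  forall v, AM P M u v = 0 /\ AM P M v u = 0.
Proof.
move=> du0 ju0 v.
have a0 i : (0 < i < N)%N -> avg (dx u) i = 0.
  move=> hi; rewrite (@avg_ext _ (fun=> 0) i hi) // avg_interior //.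
  by rewrite horner0 addr0 mul0r.
have j0 i : (0 < i < N)%N -> jump (dx (dx u)) i = 0.
  move=> hi; rewrite (@jump_ext _ (fun=> 0) i hi) //.
    by rewrite /Defs.jump horner0 subr0.
  by move=> j jN; rewrite {1}/dx du0 // deriv0.
rewrite !AME; split; rewrite big_nat_cond big1 ?add0r.
- rewrite big_nat_cond big1 // => i /andP[hi _].
  rewrite /Defs.Fl a0 // j0 // mulr0 !addr0 mulrDr.
  have Mu := ju0 i hi.
  rewrite [X in X + _](_ : _ = (avg M i * jump u i) * (beta0 P / h * jump v i)).
    by rewrite [X in _ + X](_ : _ = (avg M i * jump u i) * avg (dx v) i);
      [rewrite Mu !mul0r addr0|ring].
  by ring.
- by move=> j /andP[/andP[_ jN] _]; rewrite du0 // mulr0 mul0r linear0.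
- rewrite big_nat_cond big1 // => i /andP[hi _].
  by rewrite a0 // mul0r addr0 mulrCA ju0 // mulr0.
- by move=> j /andP[/andP[_ jN] _]; rewrite du0 // mulr0 linear0.
Qed.

(** Summation by parts: in [g j i] the cell [j] supplies the one-sided values and [i] is the node,
    so an interior node collects one term from each adjacent cell. *)
Lemma sum_bracket (g : nat -> nat -> R) :
  \sum_(0 <= j < N) bracket j (g j) =
  g N.-1 N - g 0%N 0%N + \sum_(1 <= i < N) (g i.-1 i - g i i).
Proof.
have := ncell_gt0 Mh; case: N => // n _ /=.
elim: n => [|n IH]; first by rewrite big_nat1 big_geq // addr0.
rewrite big_nat_recr //= IH [in RHS]big_nat_recr //= /bracket; ring.
Qed.

End DGForms.

(** Each cell touches at most two interior interfaces. *)
Lemma sum_interior_le (R : realType) (n : nat) (Q : nat -> R) :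
  (forall j, (j < n)%N -> 0 <= Q j) ->
  \sum_(1 <= i < n) (Q i + Q i.-1) <= 2%:R * \sum_(0 <= j < n) Q j.
Proof.
case: n => [|n] Q0; first by rewrite !big_geq // mulr0.
rewrite big_split /= mulr_natl mulr2n; apply: lerD.
  by rewrite [leRHS]big_nat_recl // big_add1 /= lerDr Q0.
by rewrite big_add1 /= [leRHS]big_nat_recr // lerDl Q0.
Qed.

(** * Coercivity of the bilinear form for a large penalty *)

Section DGSums.
Variables (R : realType) (Mh : mesh R) (k : nat).
Local Notation N := (ncell Mh).
Local Notation x := (node Mh).
Local Notation h := (hx Mh).
Local Notation cint j := (poly_int (node Mh j) (node Mh j.+1)).
Local Notation jump := (jump Mh).
Local Notation avg := (avg Mh).
Local Notation Fl := (Fl Mh).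
Local Notation AM := (AM Mh).
Local Notation posM M := (positive_on_cells Mh M).
Implicit Types (u v w M : broken R) (P : flux_param R) (s : R).

Lemma avg_ge0 M i : posM M -> (0 < i < N)%N -> 0 <= avg M i.
Proof.
move=> M0 hi; rewrite avg_interior //; move/andP: hi => [i0 iN].
have iN' : (i.-1 < N)%N by exact: leq_ltn_trans (leq_pred i) iN.
have [+ _] := horner_endpoints_ge0 (node_lt iN) (M0 i iN).
have [_] := horner_endpoints_ge0 (node_lt iN') (M0 i.-1 iN').
by rewrite prednK // => ? ?; rewrite divr_ge0 // addr_ge0.
Qed.

Lemma cell_sqr_ge0 M w j : posM M -> (j < N)%N -> 0 <= cint j (M j * w j * w j).
Proof. by move=> M0 jN; exact: (weighted_sqr_ge0 (M0 j jN)). Qed.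

(** The derivative terms split into the linear forms [w(x_i) + b1 h w'(x_i)] of the right cell and
    [w(x_i) - b1 h w'(x_i)] of the left cell, with [w] the derivative of [u]. The trace inequality
    applies to each with [s = avg M i * jump u i], and [K] is fixed before [beta0]. *)
Lemma AM_interface_lower M (b1 : R) i : posM M -> (0 < i < N)%N ->
  exists K, forall P u, beta1 P = b1 -> in_Vh Mh k u ->
    beta0 P / h * (avg M i * jump u i ^+ 2) - (avg M i * jump u i) ^+ 2 * K
    - 4%:R^-1 * (cint i (M i * dx u i * dx u i) +
                 cint i.-1 (M i.-1 * dx u i.-1 * dx u i.-1)) <=
    avg M i * (Fl P u i * jump u i + avg (dx u) i * jump u i).
Proof.
move=> M0 hi; have /andP[i0 iN] := hi.
have iN' : (i.-1 < N)%N by exact: leq_ltn_trans (leq_pred i) iN.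
have lin (d : R) : linear_for *%R (fun w : {poly R} => w.[x i] + d * w^`().[x i]).
  by move=> c p q; rewrite derivD derivZ !(hornerD, hornerZ); ring.
have [Kr HKr] := weighted_trace (node_lt iN) (M0 i iN) k (lin (b1 * h)).
have [Kl HKl] := weighted_trace (node_lt iN') (M0 i.-1 iN') k (lin (- (b1 * h))).
exists (Kr + Kl) => P u b1P Vu.
have sz j : (j < N)%N -> (size (dx u j) <= k)%N.
  move=> jN; rewrite /dx; have [->|un0] := eqVneq (u j) 0.
    by rewrite deriv0 size_poly0.
  by rewrite -ltnS; apply: leq_trans (Vu j jN); exact: lt_size_deriv.
have := HKr _ (avg M i * jump u i) (sz _ iN).
have := HKl _ (avg M i * jump u i) (sz _ iN').
set Ql := cint i.-1 _; set Qr := cint i _; set a := avg M i; set J := jump u i => h1 h2.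
have -> : a * (Fl P u i * J + avg (dx u) i * J) =
  beta0 P / h * (a * J ^+ 2)
  + (a * J) * ((dx u i).[x i] + b1 * h * (dx u i)^`().[x i])
  + (a * J) * ((dx u i.-1).[x i] + - (b1 * h) * (dx u i.-1)^`().[x i]).
  rewrite /Defs.Fl -/J b1P [avg (dx u) i]avg_interior // [jump (dx _) i]/Defs.jump.
  have dE j : dx (dx u) j = (dx u j)^`() by [].
  by rewrite !dE; field; rewrite gt_eqF // hx_gt0.
lra.
Qed.

(* Half of the energy of a cell is shared by its two interfaces, and the jump
   terms absorb the rest for [beta0] large. *)
Lemma AM_coercive M (b1 : R) : posM M ->
  exists b0, forall P u, b0 <= beta0 P -> beta1 P = b1 -> in_Vh Mh k u ->
    2%:R^-1 * \sum_(0 <= j < N) cint j (M j * dx u j * dx u j)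
    + \sum_(1 <= i < N) avg M i * jump u i ^+ 2 <= AM P M u u.
Proof.
move=> M0.
have /choice[K HK] : forall i, exists K, (0 < i < N)%N ->
  forall P u, beta1 P = b1 -> in_Vh Mh k u ->
    beta0 P / h * (avg M i * jump u i ^+ 2) - (avg M i * jump u i) ^+ 2 * K
    - 4%:R^-1 * (cint i (M i * dx u i * dx u i) +
                 cint i.-1 (M i.-1 * dx u i.-1 * dx u i.-1)) <=
    avg M i * (Fl P u i * jump u i + avg (dx u) i * jump u i).
  move=> i; have [hi|] := boolP (0 < i < N)%N; last by exists 0.
  by have [K HK] := AM_interface_lower b1 M0 hi; exists K.
(* With this bound [beta0 P / h - avg M i * K i] is at least 1 at every interface. *)
exists (h * (1 + \sum_(1 <= i < N) `|avg M i * K i|)) => P u b0 b1P Vu.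
rewrite AME; set Q := fun j => cint j (M j * dx u j * dx u j).
have Q0 j : (j < N)%N -> 0 <= Q j by exact: cell_sqr_ge0.
have := sum_interior_le Q0; set S := \sum_(0 <= j < N) Q j => SQ.
have : \sum_(1 <= i < N) (avg M i * jump u i ^+ 2 - 4%:R^-1 * (Q i + Q i.-1)) <=
  \sum_(1 <= i < N) avg M i * (Fl P u i * jump u i + avg (dx u) i * jump u i).
  rewrite big_nat_cond [leRHS]big_nat_cond; apply: ler_sum => i /andP[hi _].
  apply: le_trans (HK i hi P u b1P Vu); rewrite lerD2r.
  set a := avg M i; set J := jump u i.
  have a0 : 0 <= a by exact: avg_ge0.
  have -> : beta0 P / h * (a * J ^+ 2) - (a * J) ^+ 2 * K i =
            (a * J ^+ 2) * (beta0 P / h - a * K i) by ring.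
  apply: ler_peMr; first by rewrite mulr_ge0 // sqr_ge0.
  rewrite lerBrDr ler_pdivlMr ?hx_gt0 // mulrC (le_trans _ b0) // ler_pM2l ?hx_gt0 //.
  rewrite lerD2l (le_trans (ler_norm _)) //.
  rewrite (bigD1_seq i) /= ?mem_index_iota ?iota_uniq // lerDl.
  by apply: sumr_ge0.
rewrite sumrB -mulr_sumr; move: SQ.
set A1 := \sum_(1 <= i < N) _ * _ ^+ 2; set A2 := \sum_(1 <= i < N) (Q i + _).
set A3 := \sum_(1 <= i < N) _; lra.
Qed.

End DGSums.

(** * The scheme summed over all cells *)

Section SchemeSums.
Variables (R : realType) (Mh : mesh R) (m k : nat) (D : pnp_data R m).
Local Notation N := (ncell Mh).
Local Notation x := (node Mh).
Local Notation cint j := (poly_int (node Mh j) (node Mh j.+1)).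
Local Notation jump := (jump Mh).
Local Notation avg := (avg Mh).
Local Notation AM := (AM Mh).
Local Notation posM M := (positive_on_cells Mh M).
Local Notation Vh := (in_Vh Mh k).
Local Notation q := (Defs.charge D).
Local Notation one := (fun=> 1 : {poly R}).

Lemma in_Vh_one : Vh one.
Proof. by move=> j _; rewrite size_poly1. Qed.

Lemma avg_one i : (0 < i < N)%N -> avg one i = 1.
Proof. by move=> hi; rewrite avg_interior // !hornerE; field. Qed.

Lemma positive_one : posM one.
Proof. by move=> j _ y _; rewrite hornerC. Qed.

Lemma avg_first u : avg u 0 = (u 0%N).[x 0%N].
Proof. by []. Qed.

Lemma avg_last u : avg u N = (u N.-1).[x N].
Proof. by rewrite /Defs.avg gtn_eqF ?ncell_gt0 // eqxx. Qed.

Lemma AM_one P M u : AM P M u one = 0.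
Proof.
apply: (AM_flat P _ _ u).2 => [j _|i hi]; first by rewrite /dx derivC.
by rewrite /Defs.jump !hornerC subrr mulr0.
Qed.

(** Both sums of the lower bound are nonnegative, hence vanish term by term. The conclusion is
    exactly what [AM_flat] requires. *)
Lemma AM_eq0_flat P M u : posM M ->
  2%:R^-1 * \sum_(0 <= j < N) cint j (M j * dx u j * dx u j)
    + \sum_(1 <= i < N) avg M i * jump u i ^+ 2 <= AM P M u u ->
  AM P M u u = 0 ->
  (forall j, (j < N)%N -> dx u j = 0) /\
  (forall i, (0 < i < N)%N -> avg M i * jump u i = 0).
Proof.
move=> M0 + A0; rewrite A0.
set S1 := \sum_(0 <= j < N) _; set S2 := \sum_(1 <= i < N) _ => S12.
have Q0 j : j \in index_iota 0 N -> true -> 0 <= cint j (M j * dx u j * dx u j).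
  by rewrite mem_index_iota => /andP[_ jN] _; exact: cell_sqr_ge0.
have J0 i : i \in index_iota 1 N -> true -> 0 <= avg M i * jump u i ^+ 2.
  by rewrite mem_index_iota => hi _; rewrite mulr_ge0 ?sqr_ge0 // avg_ge0.
have S10 : 0 <= S1 by rewrite /S1 big_seq; apply: sumr_ge0 => j /Q0; exact.
have S20 : 0 <= S2 by rewrite /S2 big_seq; apply: sumr_ge0 => j /J0; exact.
have [S1E S2E] : S1 = 0 /\ S2 = 0 by split; lra.
split=> [j jN|i hi].
  apply: (weighted_sqr_eq0 (node_lt jN) (M0 j jN)).
  move/eqP: S1E; rewrite /S1 big_seq psumr_eq0; last by move=> l /Q0; exact.
  by move=> /allP /(_ j); rewrite mem_index_iota jN => /(_ isT) /eqP.
apply/eqP; move/eqP: S2E; rewrite /S2 big_seq psumr_eq0; last by move=> l /J0; exact.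
move=> /allP /(_ i); rewrite mem_index_iota hi => /(_ isT).
by rewrite !mulf_eq0 orbb.
Qed.

(** The load functional of the Poisson problem, with the Neumann data included. *)
Definition source (c : 'I_m -> broken R) (eta : broken R) : R :=
  \sum_(0 <= j < N) cell_int Mh j (fun y =>
     (\sum_(i < m) q i * (c i j).[y] + rho0 D y) * (eta j).[y])
  + bdry_int Mh (sigma_a D) (sigma_b D) eta.

(** At the two ends [psi] equals its average, so only the [sigma] terms survive and they move into
    [source]. At an interior node [psi^+ - {psi}] and [psi^- - {psi}] are plus and minus half the
    jump, which yields [{eta'}[psi]]. *)
Lemma poisson_AM Ps c psi : poisson_eq Mh D k Ps c psi ->
  forall eta, Vh eta -> AM Ps one psi eta = source c eta.
Proof.
move=> Ppsi eta Veta; rewrite /source.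
rewrite -(eq_big_nat _ _ (fun j hj => Ppsi eta Veta j (andP hj).2)).
rewrite sumrB /= (sum_bracket Mh (fun j i =>
  hat_psi Mh Ps (sigma_a D) (sigma_b D) psi i * (eta j).[x i] +
  ((psi j).[x i] - avg psi i) * (dx eta j).[x i])) /=.
have -> : hat_psi Mh Ps (sigma_a D) (sigma_b D) psi N = sigma_b D.
  by rewrite /hat_psi gtn_eqF ?ncell_gt0 // eqxx.
have -> : hat_psi Mh Ps (sigma_a D) (sigma_b D) psi 0 = sigma_a D by [].
rewrite avg_first avg_last !subrr !mul0r !addr0 /bdry_int.
rewrite [X in X - (_ + _)](_ : _ = \sum_(0 <= j < N) cint j (dx psi j * dx eta j)).
  rewrite AME [X in X + _ = _](_ : _ = \sum_(0 <= j < N) cint j (dx psi j * dx eta j)).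
    rewrite [X in _ + X = _](_ : _ = - (\sum_(1 <= i < N)
     (hat_psi Mh Ps (sigma_a D) (sigma_b D) psi i * (eta i.-1).[x i] +
      ((psi i.-1).[x i] - avg psi i) * (dx eta i.-1).[x i] -
      (hat_psi Mh Ps (sigma_a D) (sigma_b D) psi i * (eta i).[x i] +
       ((psi i).[x i] - avg psi i) * (dx eta i).[x i])))); first by ring.
    rewrite -sumrN; apply: eq_big_nat => i hi.
    rewrite avg_one // mul1r !avg_interior // /hat_psi /Defs.jump.
    by have /andP[i0 iN] := hi; rewrite gtn_eqF // ltn_eqF //; field.
  by apply: eq_bigr => j _; rewrite mul1r.
by apply: eq_bigr => j _; apply: cell_int_horner => y; rewrite hornerM.
Qed.

Lemma euler_AM Pp dt c c' p : 0 < dt -> euler_eq Mh k Pp dt c c' p ->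
  forall v, Vh v ->
  \sum_(0 <= j < N) cint j ((c' j - c j) * v j) = - (dt * AM Pp c p v).
Proof.
move=> dt0 Ec v Vv.
have : \sum_(0 <= j < N) cell_int Mh j (fun y => ((c' j).[y] - (c j).[y]) / dt * (v j).[y])
   = - AM Pp c p v.
  rewrite (eq_big_nat _ _ (fun j hj => Ec v Vv j (andP hj).2)).
  rewrite big_split /= sumrN (sum_bracket Mh (fun j i =>
    avg c i * (hat_p Mh Pp p i * (v j).[x i]
                   + ((p j).[x i] - avg p i) * (dx v j).[x i]))) /=.
  have -> : hat_p Mh Pp p N = 0 by rewrite /hat_p ltnn andbF.
  have -> : hat_p Mh Pp p 0 = 0 by [].
  rewrite (avg_first p) (avg_last p) !mul0r !add0r.
  rewrite !subrr !mul0r !mulr0 subrr add0r AME opprD; congr (- _ + _).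
    by apply: eq_bigr => j _; apply: cell_int_horner => y; rewrite !hornerM.
  rewrite -sumrN; apply: eq_big_nat => i hi.
  by rewrite /hat_p hi (avg_interior p hi) (avg_interior (dx v) hi) /Defs.jump; field.
rewrite -mulrN => <-; rewrite mulr_sumr; apply: eq_bigr => j _.
rewrite (@cell_int_horner _ _ _ _ (dt^-1 *: ((c' j - c j) * v j))).
  by rewrite linearZ /= mulrA divff ?mul1r // gt_eqF.
by move=> y; rewrite hornerZ hornerM hornerD hornerN; field; rewrite gt_eqF.
Qed.

End SchemeSums.

Lemma Rintegral_itv_sum (R : realType) (a b : R) (J : Type) (s : seq J)
    (f : J -> R -> R) :
  (forall i, (@lebesgue_measure R).-integrable `]a, b[%classic (EFin \o f i)) ->
  (@lebesgue_measure R).-integrable `]a, b[%classic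
     (EFin \o (fun y => \sum_(i <- s) f i y)) /\
  \int[@lebesgue_measure R]_(y in `]a, b[%classic) (\sum_(i <- s) f i y) =
  \sum_(i <- s) \int[@lebesgue_measure R]_(y in `]a, b[%classic) f i y.
Proof.
move=> intf; elim: s => [|i s [IH1 IH2]].
  have E : (fun y : R => \sum_(i <- [::]) f i y) = horner 0.
    by apply/funext => y; rewrite big_nil horner0.
  rewrite E big_nil; split; first exact: integrable_horner.
  exact: (linear0 (poly_int a b)).
have E : (fun y : R => \sum_(l <- i :: s) f l y) =
    (fun y => f i y + \sum_(l <- s) f l y).
  by apply/funext => y; rewrite big_cons.
rewrite E big_cons -IH2; split; first exact: integrable_addr.
exact: (@RintegralD _ _ _ (@lebesgue_measure R) _ _ _ (measurable_itv _) (intf i) IH1).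
Qed.

(** * Entropy and electrostatic parts of the free energy *)

Section Energy.
Variables (R : realType) (Mh : mesh R) (m k : nat) (D : pnp_data R m).
Hypothesis hrho0 : (@lebesgue_measure R).-integrable (Omega Mh) (EFin \o rho0 D).
Local Notation N := (ncell Mh).
Local Notation x := (node Mh).
Local Notation mu := (@lebesgue_measure R).
Local Notation cint j := (poly_int (node Mh j) (node Mh j.+1)).
Local Notation posM M := (positive_on_cells Mh M).
Local Notation q := (Defs.charge D).

Lemma node_le i j : (i <= j)%N -> (j <= N)%N -> x i <= x j.
Proof.
move=> ij jN; elim: j ij jN => [|j IH]; first by rewrite leqn0 => /eqP->.
rewrite leq_eqVlt ltnS => /predU1P[->//|ij] jN.
exact: le_trans (IH ij (ltnW jN)) (ltW (node_lt jN)).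
Qed.

Lemma integrable_rho0_cell j : (j < N)%N ->
  mu.-integrable (cell Mh j) (EFin \o rho0 D).
Proof.
move=> jN; apply: (@integrableS _ _ _ mu (Omega Mh)) hrho0.
- exact: measurable_itv.
- exact: measurable_itv.
- move=> y; rewrite /cell /Omega /= !in_itv /= => /andP[jy yj].
  rewrite (le_trans (node_le (leq0n j) (ltnW jN)) (ltW jy)) /=.
  exact: le_trans (ltW yj) (node_le jN (leqnn N)).
Qed.

Definition charge_poly (c : 'I_m -> broken R) (j : nat) : {poly R} :=
  \sum_(i < m) q i *: c i j.

Lemma charge_polyE c j y : (charge_poly c j).[y] = \sum_(i < m) q i * (c i j).[y].
Proof. by rewrite /charge_poly horner_sum; apply: eq_bigr => i _; rewrite hornerZ. Qed.

Lemma source_cell c j (e : {poly R}) : (j < N)%N ->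
  mu.-integrable (cell Mh j)
    (EFin \o (fun y => (\sum_(i < m) q i * (c i j).[y] + rho0 D y) * e.[y])) /\
  cell_int Mh j (fun y => (\sum_(i < m) q i * (c i j).[y] + rho0 D y) * e.[y]) =
  \sum_(i < m) q i * cint j (c i j * e) + cell_int Mh j (fun y => rho0 D y * e.[y]).
Proof.
move=> jN.
have E : (fun y => (\sum_(i < m) q i * (c i j).[y] + rho0 D y) * e.[y]) =
    (fun y => (charge_poly c j * e).[y] + rho0 D y * e.[y]).
  by apply/funext => y; rewrite hornerM charge_polyE mulrDl.
have i1 := integrable_horner (x j) (x j.+1) (charge_poly c j * e).
have i2 := integrable_mul_horner e (integrable_rho0_cell jN).
rewrite E; split; first exact: integrable_addr.
rewrite /cell_int (@RintegralD _ _ _ mu _ _ _ (measurable_itv _) i1 i2); congr (_ + _).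
rewrite -[LHS]/(cint j _) /charge_poly mulr_suml linear_sum.
by apply: eq_bigr => i _; rewrite -scalerAl linearZ.
Qed.

(** The fixed charge and the boundary data do not depend on the concentrations and cancel. *)
Lemma sourceB c c' eta :
  source Mh D c' eta - source Mh D c eta =
  \sum_(i < m) q i * \sum_(0 <= j < N) cint j ((c' i j - c i j) * eta j).
Proof.
rewrite /source opprD addrACA subrr addr0 -sumrB; under [RHS]eq_bigr do rewrite mulr_sumr.
rewrite exchange_big /=; apply: eq_big_nat => j /andP[_ jN].
rewrite !(source_cell _ _ jN).2 opprD addrACA subrr addr0 -sumrB; apply: eq_bigr => i _.
by rewrite -mulrBr -linearB -mulrBl.
Qed.

Definition entropy (c : broken R) : R :=
  \sum_(0 <= j < N) cell_int Mh j (fun y => (c j).[y] * ln (c j).[y]).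

(** In this form the Poisson equation tested with [psi] turns the electrostatic part into half of
    [AM Ps one psi psi], a quadratic form. *)
Lemma free_energyE c psi :
  free_energy Mh D c psi =
  \sum_(i < m) entropy (c i) + 2%:R^-1 * source Mh D c psi.
Proof.
rewrite /free_energy /entropy /source; set B := bdry_int _ _ _ _.
rewrite [_ * (_ + B)]mulrDr addrA; congr (_ + _).
rewrite exchange_big /= mulr_sumr -big_split /=; apply: eq_big_nat => j /andP[_ jN].
have [i1 e1] := @Rintegral_itv_sum _ (x j) (x j.+1) _ (index_enum 'I_m)
  (fun i y => (c i j).[y] * ln (c i j).[y]) (fun i => integrable_xlnx (node_lt jN) (c i j)).
have [i2 e2] := source_cell c (psi j) jN.
rewrite /cell_int -e1 -(@RintegralZl _ _ _ mu _ _ _ (measurable_itv _) i2).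
rewrite -(@RintegralD _ _ _ mu _ _ _ (measurable_itv _) i1 (integrable_mull _ i2)).
by apply: eq_Rintegral => y _; rewrite mulrA.
Qed.

(** Positivity makes [ln c] integrable on the cell, which allows the integral to be split. *)
Lemma potential_cell (qi : R) c p psi : posM c -> potential_eq Mh k qi c p psi ->
  forall j (r : {poly R}), (j < N)%N -> (size r <= k.+1)%N ->
  cint j (p j * r) = qi * cint j (psi j * r) + cell_int Mh j (fun y => ln (c j).[y] * r.[y]).
Proof.
move=> c0 Pp j r jN sr.
have := Pp (fun=> r) (fun _ _ => sr) j jN.
rewrite (@cell_int_horner _ _ _ _ (p j * r)) => [->|y]; last by rewrite hornerM.
have i1 := integrable_horner (x j) (x j.+1) (qi *: (psi j * r)).
have i2 := integrable_mul_horner r (integrable_ln_horner (node_lt jN) (c0 j jN)).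
rewrite -[qi * _]/(qi *: _) -linearZ /=.
rewrite -(@RintegralD _ _ _ mu _ _ _ (measurable_itv _) i1 i2).
by apply: eq_Rintegral => y _; rewrite hornerZ hornerM mulrDl mulrA.
Qed.

End Energy.

(** * Energy decay over one time step *)

Lemma uniform_threshold (R : realType) (J : finType) (Pr : J -> R -> Prop) :
  (forall i, exists2 tau : R, 0 < tau & forall t, 0 < t < tau -> Pr i t) ->
  exists2 tau : R, 0 < tau & forall t, 0 < t < tau -> forall i, Pr i t.
Proof.
move=> H; suff [tau tau0 Htau] : exists2 tau : R, 0 < tau &
    forall t, 0 < t < tau -> forall i, i \in enum J -> Pr i t.
  by exists tau => // t ht i; apply: Htau => //; rewrite mem_enum.
elim: (enum J) => [|i s [tau tau0 IH]]; first by exists 1.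
have [tau' tau'0 H'] := H i.
exists (Num.min tau tau'); first by rewrite lt_min tau0.
move=> t; rewrite lt_min => /and3P[t0 t1 t2] l; rewrite inE => /predU1P[->|ls].
  by apply: H'; rewrite t0.
by apply: IH => //; rewrite t0.
Qed.

Section Step.
Variables (R : realType) (Mh : mesh R) (m k : nat) (D : pnp_data R m).
Hypothesis hrho0 : (@lebesgue_measure R).-integrable (Omega Mh) (EFin \o rho0 D).
Local Notation N := (ncell Mh).
Local Notation cint j := (poly_int (node Mh j) (node Mh j.+1)).
Local Notation jump := (jump Mh).
Local Notation avg := (avg Mh).
Local Notation AM := (AM Mh).
Local Notation posM M := (positive_on_cells Mh M).
Local Notation Vh := (in_Vh Mh k).
Local Notation q := (Defs.charge D).
Local Notation one := (fun=> 1 : {poly R}).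
Local Notation source := (source Mh D).

Variables (Pp Ps : flux_param R) (C : 'I_m -> broken R).

(* [C] holds the concentrations at the earlier time level. *)
Record euler_step (dt : R) (c p : 'I_m -> broken R) (psi psi' : broken R) : Prop :=
  EulerStep {
  step_gt0 : 0 < dt;
  step_Vc : forall i, Vh (c i);
  step_Vp : forall i, Vh (p i);
  step_Vpsi : Vh psi;
  step_Vpsi' : Vh psi';
  step_potential : forall i j (r : {poly R}), (j < N)%N -> (size r <= k.+1)%N ->
    cint j (p i j * r) =
    q i * cint j (psi j * r) + cell_int Mh j (fun y => ln (C i j).[y] * r.[y]);
  step_poisson : forall eta, Vh eta -> AM Ps one psi eta = source C eta;
  step_poisson' : forall eta, Vh eta -> AM Ps one psi' eta = source c eta;
  step_euler : forall i v, Vh v ->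
    \sum_(0 <= j < N) cint j ((c i j - C i j) * v j) =
    - (dt * AM Pp (C i) (p i) v) }.

Hypothesis C_pos : forall i, posM (C i).

Lemma dg_solution_step dt cin T c p psi n : 0 < dt ->
  dg_solution Mh D k Pp Ps dt cin T c p psi -> (n < T)%N ->
  (forall i j, (j < N)%N -> c n i j = C i j) ->
  euler_step dt (c n.+1) (p n) (psi n) (psi n.+1).
Proof.
move=> dt0 [_ _ _ sol eul] nT cC.
have [Vn Vpsi pot poi] := sol n (ltnW nT).
have [Vn' Vpsi' _ poi'] := sol n.+1 nT.
have posc i : posM (c n i) by move=> j jN y hy; rewrite cC //; exact: C_pos.
split=> //.
- by move=> i; case: (Vn' i).
- by move=> i; case: (Vn i).
- move=> i j r jN sr; rewrite (potential_cell (posc i) (pot i) jN sr); congr (_ + _).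
  by apply: eq_Rintegral => y _; rewrite cC.
- move=> eta Veta; rewrite (poisson_AM poi Veta); congr (_ + _).
  apply: eq_big_nat => j /andP[_ jN]; apply: eq_Rintegral => y _.
  by congr ((_ + _) * _); apply: eq_bigr => i _; rewrite cC.
- by move=> eta Veta; exact: (poisson_AM poi' Veta).
- move=> i v Vv; rewrite -(@AM_ext _ _ Pp (c n i) (C i) (p n i) (p n i) v v) //; last exact: cC.
  rewrite -(euler_AM dt0 (eul n nT i) Vv); apply: eq_big_nat => j /andP[_ jN].
  by rewrite cC.
Qed.

Hypothesis C_Vh : forall i, Vh (C i).
Hypothesis Ps_sym : beta1 Ps = 0.
Hypothesis Ps_coercive : forall u, Vh u ->
  2%:R^-1 * \sum_(0 <= j < N) cint j (one j * dx u j * dx u j)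
    + \sum_(1 <= i < N) avg one i * jump u i ^+ 2 <= AM Ps one u u.
Hypothesis Pp_coercive : forall i u, Vh u ->
  2%:R^-1 * \sum_(0 <= j < N) cint j (C i j * dx u j * dx u j)
    + \sum_(1 <= l < N) avg (C i) l * jump u l ^+ 2 <= AM Pp (C i) u u.

Lemma Vh_orthogonal d : Vh d ->
  (forall v, Vh v -> \sum_(0 <= j < N) cint j (d j * v j) = 0) ->
  forall j, (j < N)%N -> d j = 0.
Proof.
move=> Vd Hd j jN; have one0 := @positive_one R Mh.
apply: (weighted_sqr_eq0 (node_lt jN) (one0 j jN)).
have /eqP := Hd d Vd; rewrite big_seq psumr_eq0.
  move=> /allP /(_ j); rewrite mem_index_iota jN => /(_ isT) /eqP.
  by rewrite mul1r.
move=> l; rewrite mem_index_iota => /andP[_ lN].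
by have := cell_sqr_ge0 d one0 lN; rewrite mul1r.
Qed.

Lemma cell_orthogonal j (d : {poly R}) : (j < N)%N -> cint j (d * d) = 0 -> d = 0.
Proof.
move=> jN dd; have one0 := @positive_one R Mh.
by apply: (weighted_sqr_eq0 (node_lt jN) (one0 j jN)); rewrite mul1r.
Qed.

Lemma step_increment dt c p psi psi' eta : euler_step dt c p psi psi' -> Vh eta ->
  AM Ps one (blin (-1) psi psi') eta =
  \sum_(i < m) q i * \sum_(0 <= j < N) cint j ((c i j - C i j) * eta j).
Proof.
move=> S Veta; rewrite AM_blinl (step_poisson S Veta) (step_poisson' S Veta).
by rewrite mulN1r addrC (sourceB hrho0).
Qed.

Lemma AM_step_ge0 dt c p psi psi' i : euler_step dt c p psi psi' ->
  0 <= AM Pp (C i) (p i) (p i).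
Proof.
move=> S; apply: le_trans (Pp_coercive i (step_Vp S i)); apply: addr_ge0.
  rewrite mulr_ge0 // big_seq; apply: sumr_ge0 => j.
  by rewrite mem_index_iota => /andP[_ jN]; exact: cell_sqr_ge0.
rewrite big_seq; apply: sumr_ge0 => l; rewrite mem_index_iota => hl.
by rewrite mulr_ge0 ?sqr_ge0 // avg_ge0.
Qed.

(** * Comparison of two steps that start from the same concentrations *)

Section TwoSteps.
Variables (dt dt0 : R) (c c0 p p0 : 'I_m -> broken R) (psi psi' psi0 psi0' : broken R).
Hypothesis S : euler_step dt c p psi psi'.
Hypothesis S0 : euler_step dt0 c0 p0 psi0 psi0'.
Let e := blin (-1) psi0 psi.

Let Ve : Vh e.
Proof. by apply: in_Vh_blin; [exact: step_Vpsi S0|exact: step_Vpsi S]. Qed.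

(** Both potentials have the load [source C], so [e] solves the homogeneous problem and coercivity
    applies with zero energy. *)
Lemma potential_diff_flat :
  (forall j, (j < N)%N -> dx e j = 0) /\
  (forall i, (0 < i < N)%N -> jump e i = 0).
Proof.
have Ae : AM Ps one e e = 0.
  by rewrite {1}/e AM_blinl (step_poisson S Ve) (step_poisson S0 Ve) mulN1r addNr.
have [de je] := AM_eq0_flat (@positive_one R Mh) (Ps_coercive Ve) Ae.
by split=> // i hi; have := je i hi; rewrite avg_one // mul1r.
Qed.

(** The two potential equations share the term [ln C]; testing their difference with itself leaves
    only the contribution of [e]. *)
Lemma chemical_potential_diff i j : (j < N)%N -> p i j = blin (q i) e (p0 i) j.
Proof.
move=> jN; apply/eqP; rewrite -subr_eq0; apply/eqP; apply: (cell_orthogonal jN).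
set d := p i j - _.
have sd : (size d <= k.+1)%N.
  rewrite /d (leq_trans (size_polyD _ _)) // size_polyN geq_max (step_Vp S) //=.
  exact: (in_Vh_blin (q i) Ve (step_Vp S0 i)).
have h1 := step_potential S i jN sd; have h0 := step_potential S0 i jN sd.
rewrite {1}/d /blin /e /blin.
have lin s (u v : {poly R}) : cint j ((s *: u + v) * d) = s * cint j (u * d) + cint j (v * d).
  by rewrite mulrDl -scalerAl poly_int_is_linear.
by rewrite mulrBl linearB /= !lin h1 h0; ring.
Qed.

(** The difference [q i * e] lies in the kernel of the form. Both arguments are treated, since
    [beta1 Pp] is arbitrary and the form may be unsymmetric. *)
Lemma AM_step_eq i v :
  AM Pp (C i) (p i) v = AM Pp (C i) (p0 i) v /\
  AM Pp (C i) v (p i) = AM Pp (C i) v (p0 i).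
Proof.
have [de je] := potential_diff_flat.
have je' l : (0 < l < N)%N -> avg (C i) l * jump e l = 0.
  by move=> hl; rewrite je // mulr0.
have [A1 A2] := AM_flat Pp de je' v.
have pE := @chemical_potential_diff i.
split.
  rewrite (@AM_ext _ _ Pp (C i) (C i) (p i) (blin (q i) e (p0 i)) v v) //.
  by rewrite AM_blinl A1 mulr0 add0r.
rewrite (@AM_ext _ _ Pp (C i) (C i) v v (p i) (blin (q i) e (p0 i))) //.
by rewrite AM_blinr A2 mulr0 add0r.
Qed.

(** Both rates lie in [Vh] and represent the same functional [- AM Pp (C i) (p0 i)]. *)
Lemma step_rate_eq i j : (j < N)%N ->
  dt^-1 *: (c i j - C i j) = dt0^-1 *: (c0 i j - C i j).
Proof.
move=> jN; apply/eqP; rewrite -subr_eq0; apply/eqP.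
pose d : broken R := fun j => dt^-1 *: (c i j - C i j) - dt0^-1 *: (c0 i j - C i j).
rewrite -/(d j); apply: Vh_orthogonal jN.
  have -> : d = blin (- dt0^-1) (blin (-1) (C i) (c0 i))
                (blin dt^-1 (blin (-1) (C i) (c i)) (fun=> 0)).
    apply/funext => l; rewrite /d /blin !scaleN1r addr0 scaleNr addrC.
    by rewrite ![- _ + _]addrC.
  apply: in_Vh_blin; first exact: in_Vh_blin (C_Vh i) (step_Vc S0 i).
  apply: in_Vh_blin; first exact: in_Vh_blin (C_Vh i) (step_Vc S i).
  by move=> l _; rewrite size_poly0.
move=> v Vv; rewrite (eq_bigr (fun l => dt^-1 * cint l ((c i l - C i l) * v l)
    - dt0^-1 * cint l ((c0 i l - C i l) * v l))).
  rewrite sumrB -!mulr_sumr (step_euler S i Vv) (step_euler S0 i Vv) (AM_step_eq i v).1.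
  by field; rewrite !gt_eqF ?(step_gt0 S) ?(step_gt0 S0).
by move=> l _; rewrite /d mulrBl -!scalerAl linearB !linearZ.
Qed.

(** The increments of [psi] divided by their time steps solve the same Poisson problem. Symmetry of
    the form exchanges one for the other in each argument. *)
Lemma field_energy_eq :
  AM Ps one (blin (-1) psi psi') (blin (-1) psi psi') / dt ^+ 2 =
  AM Ps one (blin (-1) psi0 psi0') (blin (-1) psi0 psi0') / dt0 ^+ 2.
Proof.
have dt_n0 : dt != 0 by rewrite gt_eqF // (step_gt0 S).
have dt0_n0 : dt0 != 0 by rewrite gt_eqF // (step_gt0 S0).
set d := blin (-1) psi psi'; set d0 := blin (-1) psi0 psi0'.
have Vd : Vh d by apply: in_Vh_blin; [exact: step_Vpsi S|exact: step_Vpsi' S].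
have Vd0 : Vh d0 by apply: in_Vh_blin; [exact: step_Vpsi S0|exact: step_Vpsi' S0].
have dd eta : Vh eta -> AM Ps one d eta / dt = AM Ps one d0 eta / dt0.
  move=> Veta; rewrite (step_increment S Veta) (step_increment S0 Veta).
  rewrite ![_ / _]mulrC !mulr_sumr; apply: eq_bigr => i _.
  rewrite mulrCA [RHS]mulrCA; congr (_ * _); rewrite !mulr_sumr.
  apply: eq_big_nat => j /andP[_ jN].
  have E (t : R) (a b : {poly R}) : t * cint j (a * b) = cint j ((t *: a) * b).
    by rewrite -scalerAl linearZ.
  by rewrite !E step_rate_eq.
rewrite !expr2 !invfM !mulrA dd // [AM _ _ d0 d](AM_sym _ _ _ _ Ps_sym).
have -> : AM Ps one d d0 = dt * (AM Ps one d0 d0 / dt0) by rewrite -dd // mulrC divfK.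
field; by rewrite dt_n0 dt0_n0.
Qed.

End TwoSteps.

(** * Expansion of the energy in the time step and choice of the threshold *)

Section Decay.
Variables (dt0 : R) (c0 p0 : 'I_m -> broken R) (psi0 psi0' : broken R).
Hypothesis S0 : euler_step dt0 c0 p0 psi0 psi0'.

(** The rate, the dissipation [a] and the quadratic coefficient [K] are read off a reference step;
    by the comparison above every step from [C] has the same ones. *)
Let G (i : 'I_m) : broken R := fun j => dt0^-1 *: (c0 i j - C i j).
Let a : R := \sum_(i < m) AM Pp (C i) (p0 i) (p0 i).
Let K : R := AM Ps one (blin (-1) psi0 psi0') (blin (-1) psi0 psi0') / dt0 ^+ 2.

Let VG i : Vh (G i).
Proof.
have -> : G i = blin dt0^-1 (blin (-1) (C i) (c0 i)) (fun=> 0).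
  by apply/funext => l; rewrite /G /blin scaleN1r addr0 [- _ + _]addrC.
apply: in_Vh_blin; first exact: in_Vh_blin (C_Vh i) (step_Vc S0 i).
by move=> l _; rewrite size_poly0.
Qed.

Let rate_AM i v : Vh v ->
  \sum_(0 <= j < N) cint j (G i j * v j) = - AM Pp (C i) (p0 i) v.
Proof.
move=> Vv; rewrite (eq_bigr (fun j => dt0^-1 * cint j ((c0 i j - C i j) * v j))).
  rewrite -mulr_sumr (step_euler S0 i Vv) mulrN mulrA mulVf ?mul1r //.
  by rewrite gt_eqF // (step_gt0 S0).
by move=> j _; rewrite -scalerAl linearZ.
Qed.

Let step_concentration dt c p psi psi' : euler_step dt c p psi psi' ->
  forall i j, (j < N)%N -> c i j = C i j + dt *: G i j.
Proof.
move=> S i j jN; rewrite /G -(step_rate_eq S S0 i jN) scalerA divff ?scale1r.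
  by rewrite addrC subrK.
by rewrite gt_eqF // (step_gt0 S).
Qed.

(** With [psi' = psi + d], symmetry gives [AM d psi + AM d d / 2] for the change of field energy:
    the first term is linear in [dt] through [G], the second is [dt^2 K / 2]. *)
Let free_energy_increment dt c p psi psi' : euler_step dt c p psi psi' ->
  free_energy Mh D c psi' - free_energy Mh D C psi =
  \sum_(i < m) (entropy Mh (c i) - entropy Mh (C i)
    + dt * (q i * \sum_(0 <= j < N) cint j (G i j * psi j)))
  + 2%:R^-1 * (dt ^+ 2 * K).
Proof.
move=> S; rewrite !(free_energyE hrho0).
rewrite -(step_poisson' S (step_Vpsi' S)) -(step_poisson S (step_Vpsi S)).
move dE : (blin (-1) psi psi') => d.
have -> : psi' = blin 1 d psi.
  by apply/funext => j; rewrite -dE /blin scale1r scaleN1r addrAC addNr add0r.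
rewrite AM_blinl !AM_blinr !mul1r [AM _ _ psi d](AM_sym _ _ _ _ Ps_sym).
have -> : dt ^+ 2 * K = AM Ps one d d.
  rewrite /K -(field_energy_eq S S0) dE mulrC divfK // expf_neq0 // gt_eqF //.
  exact: step_gt0 S.
rewrite big_split /= sumrB.
have -> : \sum_(i < m) dt * (q i * \sum_(0 <= j < N) cint j (G i j * psi j)) =
    AM Ps one d psi.
  rewrite -dE (step_increment S (step_Vpsi S)); apply: eq_bigr => i _.
  rewrite mulrCA; congr (_ * _); rewrite mulr_sumr; apply: eq_big_nat => j /andP[_ jN].
  by rewrite (step_concentration S) // addrAC subrr add0r -(scalerAl dt) poly_intZ.
by field.
Qed.

(** When [a = 0] no dissipation is left to absorb the errors of the expansion. Each [p0 i] then lies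
    in the kernel of its form, so [G = 0] and nothing in the energy changes. *)
Let free_energy_stationary dt c p psi psi' : a = 0 -> euler_step dt c p psi psi' ->
  free_energy Mh D c psi' = free_energy Mh D C psi.
Proof.
move=> a0 S; apply/eqP; rewrite -subr_eq0; apply/eqP.
have ai i : AM Pp (C i) (p0 i) (p0 i) = 0.
  move/eqP: a0; rewrite /a psumr_eq0 => [/allP /(_ i)|l _]; last exact: AM_step_ge0 S0.
  by rewrite mem_index_enum => /(_ isT) /eqP.
have G0 i j : (j < N)%N -> G i j = 0.
  apply: Vh_orthogonal (VG i) _ j => v Vv; rewrite rate_AM //.
  have [d0 j0] := AM_eq0_flat (C_pos i) (Pp_coercive i (step_Vp S0 i)) (ai i).
  by rewrite (AM_flat Pp d0 j0 v).1 oppr0.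
have cC i j : (j < N)%N -> c i j = C i j.
  by move=> jN; rewrite (step_concentration S) // G0 // scaler0 addr0.
have K0 : dt ^+ 2 * K = 0.
  rewrite /K -(field_energy_eq S S0) (step_increment S).
    rewrite big1 ?mul0r ?mulr0 // => i _; rewrite big_nat_cond big1 ?mulr0 //.
    by move=> j /andP[/andP[_ jN] _]; rewrite cC // subrr mul0r linear0.
  by apply: in_Vh_blin; [exact: step_Vpsi S|exact: step_Vpsi' S].
rewrite (free_energy_increment S) K0 mulr0 addr0 big1 // => i _.
rewrite [X in _ + dt * (_ * X)]big_nat_cond big1 ?mulr0 ?addr0.
  apply/eqP; rewrite subr_eq0; apply/eqP; apply: eq_big_nat => j /andP[_ jN].
  by rewrite cC.
by move=> j /andP[/andP[_ jN] _]; rewrite G0 // mul0r linear0.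
Qed.

Lemma free_energy_decay : exists2 tau : R, 0 < tau &
  forall dt c p psi psi', euler_step dt c p psi psi' -> dt < tau ->
    free_energy Mh D c psi' - free_energy Mh D C psi <=
    - (dt * (2%:R^-1 * \sum_(i < m) AM Pp (C i) (p i) (p i))).
Proof.
have aE dt c p psi psi' : euler_step dt c p psi psi' ->
    \sum_(i < m) AM Pp (C i) (p i) (p i) = a.
  move=> S; apply: eq_bigr => i _.
  by rewrite (AM_step_eq S S0 i _).1 (AM_step_eq S S0 i _).2.
have a_ge0 : 0 <= a by apply: sumr_ge0 => i _; exact: AM_step_ge0 S0.
have [a0|an0] := eqVneq a 0.
  exists 1 => // dt c p psi psi' S _.
  by rewrite (aE _ _ _ _ _ S) a0 (free_energy_stationary a0 S) subrr !mulr0 oppr0.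
have a_gt0 : 0 < a by rewrite lt_def an0.
(* The [m * N] entropy errors, one per species and cell, add up to at most [a / 4]; the successor
   keeps the denominator nonzero. *)
pose eps := a / (4%:R * (m * N).+1%:R).
have eps0 : 0 < eps by rewrite divr_gt0 // mulr_gt0.
pose Incr (ij : 'I_m * 'I_N) (t : R) :=
  let: (i, j) := ij in
  cell_int Mh j (fun y => (C i j + t *: G i j).[y] * ln (C i j + t *: G i j).[y])
  - cell_int Mh j (fun y => (C i j).[y] * ln (C i j).[y]) <=
  t * (cell_int Mh j (fun y => ln (C i j).[y] * (G i j).[y]) + cint j (G i j) + eps).
have [tau tau0 Htau] : exists2 tau : R, 0 < tau &
    forall t, 0 < t < tau -> forall ij, Incr ij t.
  apply: uniform_threshold => -[i j].
  have [tau tau0 Htau] := entropy_increment (node_lt (ltn_ord j)) (G i j)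
    (@C_pos i j (ltn_ord j)) eps0.
  by exists tau => // t ht; exact: Htau t ht.
(* The second bound gives [dt * K / 2 <= a / 4], so that of the dissipation [a] at least [a / 2]
   remains. *)
exists (Num.min tau (a / (2%:R * (`|K| + 1)))).
  by rewrite lt_min tau0 divr_gt0 // mulr_gt0 // ltr_pwDr.
move=> dt c p psi psi' S; rewrite lt_min => /andP[dt1 dt2].
have dt_gt0 := step_gt0 S.
rewrite (aE _ _ _ _ _ S) (free_energy_increment S).
have entr i : entropy Mh (c i) - entropy Mh (C i)
    + dt * (q i * \sum_(0 <= j < N) cint j (G i j * psi j)) <=
    dt * (- AM Pp (C i) (p0 i) (p0 i) + N%:R * eps).
  (* The rate is tested with the current [p i], whose potential equation turns the product into the
     first variation [ln C + q psi]. *)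
  have -> : - AM Pp (C i) (p0 i) (p0 i) = - AM Pp (C i) (p0 i) (p i).
    by rewrite (AM_step_eq S S0 i (p0 i)).2.
  rewrite -(rate_AM i (step_Vp S i)).
  have -> : \sum_(0 <= j < N) cint j (G i j * p i j) =
      q i * \sum_(0 <= j < N) cint j (G i j * psi j)
      + \sum_(0 <= j < N) cell_int Mh j (fun y => ln (C i j).[y] * (G i j).[y]).
    rewrite mulr_sumr -big_split; apply: eq_big_nat => j /andP[_ jN].
    rewrite [G i j * p i j]mulrC (step_potential S i jN (VG i jN)).
    by rewrite [psi j * G i j]mulrC.
  (* The derivative of [x ln x] is [ln x + 1]; the constant 1 contributes nothing because the rate
     has zero total mass. *)
  have mass0 : \sum_(0 <= j < N) cint j (G i j) = 0.
    rewrite (eq_bigr (fun j => cint j (G i j * 1))) => [|j _]; last by rewrite mulr1.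
    by rewrite rate_AM; [rewrite AM_one oppr0|exact: in_Vh_one].
  rewrite addrC -addrA mulrDr lerD2l -[leRHS]/(dt * (_ + _)).
  rewrite /entropy -sumrB.
  apply: (@le_trans _ _ (\sum_(0 <= j < N) dt *
    (cell_int Mh j (fun y => ln (C i j).[y] * (G i j).[y]) + cint j (G i j) + eps))).
    rewrite big_nat_cond [leRHS]big_nat_cond; apply: ler_sum => j /andP[/andP[_ jN] _].
    rewrite (step_concentration S) //.
    by apply: (Htau dt _ (i, Ordinal jN)); rewrite dt_gt0.
  rewrite -mulr_sumr !big_split /= mass0 addr0 ler_pM2l // lerD2l.
  by rewrite sumr_const_nat subn0 mulr_natl.
apply: (le_trans (lerD (ler_sum _ (fun i _ => entr i)) (lexx _))).
rewrite -mulr_sumr big_split /= sumrN -/a sumr_const card_ord -mulr_natl.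
have h1 : m%:R * (N%:R * eps) <= a / 4%:R.
  rewrite mulrA -natrM /eps invfM [a * _]mulrA mulrCA.
  by rewrite ler_piMr ?divr_ge0 // ler_pdivrMr // mul1r ler_nat.
have h2 : dt * K <= a / 2%:R.
  apply: (@le_trans _ _ (dt * (`|K| + 1))).
    rewrite ler_pM2l //; apply: (le_trans (ler_norm K)); lra.
  move: (ltW dt2); rewrite ler_pdivlMr ?mulr_gt0 ?ltr_pwDr // => ?.
  by rewrite ler_pdivlMr // -mulrA [_ * 2%:R]mulrC.
have -> : 2%:R^-1 * (dt ^+ 2 * K) = dt * (2%:R^-1 * (dt * K)) by ring.
rewrite -mulrDr -mulrN ler_pM2l //; lra.
Qed.

End Decay.
End Step.

(** * Conservation of mass and choice of the parameters *)

Theorem theorem3p3 (R : realType) (Mh : mesh R) (k m : nat) (D : pnp_data R m)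
    (hrho0 : (@lebesgue_measure R).-integrable (Omega Mh) (EFin \o rho0 D)) :
  (forall (Pp Ps : flux_param R) (dt : R) (cin : 'I_m -> R -> R) (T : nat)
          (c p : nat -> 'I_m -> broken R) (psi : nat -> broken R),
     0 < dt ->
     dg_solution Mh D k Pp Ps dt cin T c p psi ->
     forall n, (n < T)%N ->
     forall i, total_mass Mh (c n i) = total_mass Mh (c n.+1 i))
  /\
  (exists beta_psi : R,
   forall C : 'I_m -> broken R,
     (forall i, in_Vh Mh k (C i)) ->
     (forall i, positive_on_cells Mh (C i)) ->
   forall beta1_p : R,
   exists beta_p : R,
   forall Pp Ps : flux_param R,
     beta_p <= beta0 Pp -> beta1 Pp = beta1_p ->
     beta_psi <= beta0 Ps -> beta1 Ps = 0 ->
   exists mu_star : R, 0 < mu_star /\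
   forall (dt : R) (cin : 'I_m -> R -> R) (T : nat)
          (c p : nat -> 'I_m -> broken R) (psi : nat -> broken R) (n : nat),
     0 < dt ->
     0 < dt / hx Mh ^+ 2 < mu_star ->
     dg_solution Mh D k Pp Ps dt cin T c p psi ->
     (n < T)%N ->
     (forall i j, (j < ncell Mh)%N -> c n i j = C i j) ->
     (free_energy Mh D (c n.+1) (psi n.+1) - free_energy Mh D (c n) (psi n)) / dt
       <= - (2%:R^-1 * \sum_(i < m) AM Mh Pp (c n i) (p n i) (p n i))
     /\
     free_energy Mh D (c n.+1) (psi n.+1) <= free_energy Mh D (c n) (psi n)).
Proof.
split=> [Pp Ps dt cin T c p psi dt0 [_ _ _ _ eul] n nT i|].
  have := euler_AM dt0 (eul n nT i) (@in_Vh_one _ Mh k).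
  rewrite AM_one mulr0 oppr0 => /eqP; rewrite (eq_bigr (fun j =>
    poly_int (node Mh j) (node Mh j.+1) (c n.+1 i j)
    - poly_int (node Mh j) (node Mh j.+1) (c n i j))) => [|j _].
    by rewrite sumrB subr_eq0 => /eqP/esym.
  by rewrite mulr1 linearB.
(* The Poisson form has weight 1, so its penalty bound is chosen before the concentrations. *)
have [beta_psi psi_coercive] := AM_coercive k 0 (@positive_one _ Mh).
exists beta_psi => C VC C_pos beta1_p.
have /choice[b p_coercive] := fun i => AM_coercive k beta1_p (C_pos i).
(* The sum of absolute values dominates the bounds [b i] of all species at once. *)
exists (\sum_(i < m) `|b i|) => Pp Ps hPp Pp1 hPs Ps1.
have {}psi_coercive u := psi_coercive Ps u hPs Ps1.
have le_beta i : b i <= beta0 Pp.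
  apply: le_trans hPp; rewrite (bigD1 i) //= (le_trans (ler_norm _)) // lerDl.
  exact: sumr_ge0.
have {le_beta}p_coercive i u := p_coercive i Pp u (le_beta i) Pp1.
have h2 : 0 < hx Mh ^+ 2 by rewrite exprn_gt0 // hx_gt0.
(* All solutions passing through [C] share the rate of change of the
   concentrations, so that the threshold can be read off any one of them. *)
have [[dt0 [c0 [p0 [psi0 [psi0' S0]]]]]|noS] := pselect (exists dt0 c0 p0 psi0 psi0',
  euler_step Mh k D Pp Ps C dt0 c0 p0 psi0 psi0'); last first.
  exists 1; split=> // dt cin T c p psi n dt0 _ sol nT cC; exfalso; apply: noS.
  exists dt, (c n.+1), (p n), (psi n), (psi n.+1).
  exact: dg_solution_step sol nT cC.
have [tau tau0 decay] :=
  free_energy_decay hrho0 C_pos VC Ps1 psi_coercive p_coercive S0.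
exists (tau / hx Mh ^+ 2); split; first by rewrite divr_gt0.
move=> dt cin T c p psi n dt_gt0 /andP[_ dt_tau] sol nT cC.
have S := dg_solution_step C_pos dt_gt0 sol nT cC.
have {}dt_tau : dt < tau by move: dt_tau; rewrite ltr_pM2r // invr_gt0.
have -> : free_energy Mh D (c n) (psi n) = free_energy Mh D C (psi n).
  congr (_ + _); apply: eq_big_nat => j /andP[_ jN]; apply: eq_Rintegral => y _.
  by congr (_ + _ * (_ + _) * _); apply: eq_bigr => i _; rewrite cC.
have -> : \sum_(i < m) AM Mh Pp (c n i) (p n i) (p n i) =
    \sum_(i < m) AM Mh Pp (C i) (p n i) (p n i).
  by apply: eq_bigr => i _; apply: AM_ext => // j; exact: cC.
have dF := decay _ _ _ _ _ S dt_tau.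
split; first by rewrite ler_pdivrMr // mulNr [_ * dt]mulrC.
rewrite -subr_le0 (le_trans dF) // oppr_le0 mulr_ge0 ?(ltW dt_gt0) // mulr_ge0 //.
by apply: sumr_ge0 => i _; exact: (AM_step_ge0 C_pos p_coercive i S).
Qed.
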